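(* Let $X$ be a Markov chain on $\mathcal{S}=\{0,\dots,\ell-1\}$ with initial distribution $(p_i)_{i\in\mathcal{S}}$ and irreducible transition matrix $P$, and let $m$ be the associated measure. Then $m$ satisfies the multifractal formalism. More precisely, let $$E_\alpha=\Big\{x\in[0,1)\ :\ \lim_{n\to\infty}\frac{\log m(I_n(x))}{\log|I_n(x)|}=\alpha\Big\}.$$ Then for every real $\alpha$ with $-\tau'(+\infty)<\alpha<-\tau'(-\infty)$, $$\dim_H(E_\alpha)=\tau^*(\alpha),$$ where $\tau^*(\alpha)=\inf_{q\in\mathbb{R}}(\alpha q+\tau(q))$.
   Context: Let $\ell\ge 2$ be an integer and $\mathcal{S}=\{0,1,\dots,\ell-1\}$. For $n\ge1$ and a word $\varepsilon_1\cdots\varepsilon_n\in\mathcal{S}^n$ let $I_{\varepsilon_1\cdots\varepsilon_n}=\big[\sum_{i=1}^n\varepsilon_i\ell^{-i},\ \sum_{i=1}^n\varepsilon_i\ell^{-i}+\ell^{-n}\big)$; $\mathcal{F}_n$ is the set of these $\ell$-adic intervals of order $n$, $I_n(x)$ is the unique element of $\mathcal{F}_n$ containing $x\in[0,1)$, and $|I|$ is the length of $I$. A probability vector $(p_i)_{i\in\mathcal{S}}$ (initial distribution) and a stochastic matrix $P=(p_{ij})_{i,j\in\mathcal{S}}$ (transition matrix) are given; it is always assumed that $p_{ij}\neq 1$ for all $i,j$. The associated measure (measure driven by the Markov chain) is the unique Borel probability measure $m$ carried by $[0,1)$ with $m(I_{\varepsilon_1\cdots\varepsilon_n})=p_{\varepsilon_1}p_{\varepsilon_1\varepsilon_2}\cdots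 p_{\varepsilon_{n-1}\varepsilon_n}$ for all words. $P$ is irreducible if for all $i,j$ there is $n\ge1$ with $(P^n)_{ij}>0$. The structure function is $\tau(q)=\limsup_{n\to\infty}\frac{1}{n\log\ell}\log\big(\sum_{I\in\mathcal{F}_n}m(I)^q\big)$, $q\in\mathbb{R}$, with the convention $0^q=0$ for every $q\in\mathbb{R}$; it is convex and (for irreducible $P$) differentiable on $\mathbb{R}$, and $\tau'(\pm\infty)=\lim_{q\to\pm\infty}\tau'(q)$. If $m(I_n(x))=0$ then $\log m(I_n(x))=-\infty$, so such $x$ belong to no $E_\alpha$ with $\alpha$ real. $\dim_H$ is Hausdorff dimension. *)

(* Defs.v *)
From HB Require Import structures.
From mathcomp Require Import all_boot all_order all_algebra.
From mathcomp Require Import all_classical all_reals all_analysis.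

Set Implicit Arguments.
Unset Strict Implicit.
Unset Printing Implicit Defensive.

Import Order.TTheory GRing.Theory Num.Theory.
Import numFieldNormedType.Exports.

Local Open Scope classical_set_scope.
Local Open Scope ring_scope.

(** * Hausdorff dimension of subsets of the real line *)

Definition diam (R : realType) (U : set R) : \bar R :=
  ereal_sup [set `|z.1 - z.2|%:E | z in U `*` U].

(* The value on set0 is forced to be 0 because [diam set0 = -oo] and
   [poweR x 0 = 1]. *)
Definition diam_pow (R : realType) (s : R) (U : set R) : \bar R :=
  if U == set0 then 0%E else poweR (diam U) s.

(* Finite covers are included: they can be padded with set0. *)
Definition hausdorff_premeasure (R : realType) (s d : R) (A : set R) : \bar R :=
  ereal_inf [set (\sum_(0 <= i <oo) diam_pow s (U i))%E | U in
    [set U : (set R)^nat |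
      A `<=` \bigcup_i U i /\ forall i, (diam (U i) <= d%:E)%E]].

Definition hausdorff_measure (R : realType) (s : R) (A : set R) : \bar R :=
  ereal_sup [set hausdorff_premeasure s d A | d in [set d : R | 0 < d]].

Definition hausdorff_dim (R : realType) (A : set R) : \bar R :=
  ereal_inf [set s%:E | s in
    [set s : R | 0 <= s /\ hausdorff_measure s A = 0%E]].

(** * [l]-adic intervals *)

(* Positions in a tuple are numbered from 0, hence the exponent [i.+1]. *)
Definition cylinder_left (R : realType) (l n : nat) (w : n.-tuple 'I_l) : R :=
  \sum_(i < n) (tnth w i)%:R * l%:R ^- i.+1.

Definition cylinder (R : realType) (l n : nat) (w : n.-tuple 'I_l) : set R :=
  `[cylinder_left R w, cylinder_left R w + l%:R ^- n[.

Arguments cylinder R {l n} w.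

Definition adic (R : realType) (l n : nat) : set (set R) :=
  range (@cylinder R l n).

Arguments adic R l n : clear implicits.

(* For [x] in [0, 1[, the unique element of [adic R l n] containing [x]
   (set0 is a default value, for [x] outside [0, 1[). *)
Definition adic_at (R : realType) (l n : nat) (x : R) : set R :=
  xget set0 [set I | adic R l n I /\ I x].

(** * Measures driven by Markov chains *)

Definition prob_vector (R : realType) (l : nat) (p : 'I_l -> R) : Prop :=
  (forall i, 0 <= p i) /\ \sum_i p i = 1.

Definition stochastic (R : realType) (l : nat) (P : 'M[R]_l) : Prop :=
  forall i, prob_vector (P i).

Definition irreducible_mx (R : realType) (l : nat) (P : 'M[R]_l) : Prop :=
  forall i j, exists n : nat, (1 <= n)%N /\ 0 < (P ^+ n) i j.

(* [zip w (behead w)] lists the pairs of consecutive letters of [w]. *)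
Definition word_weight (R : realType) (l : nat) (p : 'I_l -> R) (P : 'M[R]_l)
    (w : seq 'I_l) : R :=
  if w is i :: _ then p i * \prod_(e <- zip w (behead w)) P e.1 e.2 else 1.

Definition markov_measure (R : realType) (l : nat) (p : 'I_l -> R)
    (P : 'M[R]_l) (m : probability (measurableTypeR R) R) : Prop :=
  m (`[0, 1[%classic : set R) = 1%E /\
  forall (n : nat) (w : n.-tuple 'I_l), (1 <= n)%N ->
    m (cylinder R w) = (word_weight p P w)%:E.

(** * Multifractal formalism *)

Section multifractal.
Variables (R : realType) (l : nat) (m : probability (measurableTypeR R) R).

(* The test implements the convention 0^q = 0 for all q; [powR 0 0] is 1. *)
Definition partition_sum (n : nat) (q : R) : R :=
  \sum_(I \in adic R l n) (if m I == 0%E then 0 else powR (fine (m I)) q).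

Definition tau (q : R) : \bar R :=
  limn_esup (fun n : nat =>
    ((n%:R * ln l%:R)^-1 * ln (partition_sum n q))%:E).

(* [tau] is finite for measures driven by Markov chains. *)
Definition tau_deriv : R -> R := derive1 (fun q => fine (tau q)).

Definition tau_deriv_pinfty : \bar R := lim ((tau_deriv q)%:E @[q --> +oo%R]).

Definition tau_deriv_ninfty : \bar R := lim ((tau_deriv q)%:E @[q --> -oo%R]).

Definition tau_star (a : R) : \bar R :=
  ereal_inf (range (fun q : R => ((a * q)%:E + tau q)%E)).

(* [lne 0 = -oo], so the quotient is +oo as soon as [m (adic_at l n x) = 0]
   and n >= 1. *)
Definition level_set (a : R) : set R :=
  [set x : R | 0 <= x < 1 /\
    (lne (m (adic_at l n x)) / lne (lebesgue_measure (adic_at l n x)))%E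
      @[n --> \oo] --> a%:E].

End multifractal.

(* Main.v *)
Require Import Defs.
From mathcomp Require Import all_boot all_order all_algebra.
From mathcomp Require Import all_classical all_reals all_analysis.
From mathcomp Require Import ring lra zify.

Set Implicit Arguments.
Unset Strict Implicit.
Unset Printing Implicit Defensive.

Import Order.TTheory GRing.Theory Num.Theory.
Import numFieldNormedType.Exports.

Local Open Scope classical_set_scope.
Local Open Scope ring_scope.

(** Write [M(q)] for the matrix of the [p_ij ^ q] (with [0 ^ q = 0]) and
    [(rho(q), v)] for its Perron pair. The weights
    [m(I_w) ^ q * rho(q) ^ (- |w|) * v_(last letter of w)] are consistent, so
    they define a Gibbs measure, and they give [tau = ln rho / ln l].
    Conjugating [M(q)] by [v] yields a stochastic matrix [Q]; perturbing [v] to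
    [v * exp (h x)], with [x] solving a Poisson equation for [Q], turns the
    Collatz--Wielandt bounds into exact tangent lines for [ln rho]. This gives
    convexity and differentiability of [tau] together, hence some [q] with
    [tau'(q) = - alpha] and [tau*(alpha) = alpha q + tau(q)].
    Upper bound: for every large [n], a point of the level set lies in a cylinder
    of order [n] with [m(I) = |I| ^ (alpha +- e)], and the partition function
    bounds the number of such cylinders.
    Lower bound: by differentiability of [tau] and Chernoff's bound, the Gibbs
    measure charges the level set, and there it is comparable with
    [|I| ^ tau*(alpha)]. Sequences that are eventually [l - 1] are not digit
    expansions, but they are null because no [p_ii] equals 1. *)

(** * Perron--Frobenius theory *)

Section finite_bounds.
Context {R : realType} {T : finType}.
Implicit Type f : T -> R.

Lemma fin_pos_lb f : (forall x, 0 < f x) -> exists2 c, 0 < c & forall x, c <= f x.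
Proof.
move=> f0; exists (\big[Num.min/1]_x f x); last by move=> x; exact: bigmin_le.
by apply/bigmin_gtP; split.
Qed.

Lemma fin_ub f : exists2 C, 0 < C & forall x, f x <= C.
Proof.
exists (\big[Num.max/1]_x f x); last by move=> x; exact: le_bigmax.
by apply/bigmax_gtP; left.
Qed.

Lemma argmax_exists f (x0 : T) : exists x, forall y, f y <= f x.
Proof.
exists [arg max_(x > x0) f x]%O.
by case: arg_maxP => // x _ H y; exact: H.
Qed.

Lemma argmin_exists f (x0 : T) : exists x, forall y, f x <= f y.
Proof.
have [x H] := argmax_exists (fun y => - f y) x0.
by exists x => y; rewrite -lerN2.
Qed.

End finite_bounds.

Section nonnegative_operator.
Context {R : realType} {l : nat} (M : 'I_l -> 'I_l -> R).
Hypothesis M0 : forall i j, 0 <= M i j.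
Implicit Types (w z : 'I_l -> R) (t : R).

Definition op w : 'I_l -> R := fun i => \sum_j M i j * w j.

(** Phrased through closed sets of states, irreducibility depends only on the positions of the zeros
    of [M], so it passes from [P] to its entrywise powers and to their conjugates. *)
Definition irreducible_op := forall A : {set 'I_l}, A != finset.set0 ->
  (forall i j, i \in A -> j \notin A -> M i j = 0) -> A = [set: 'I_l]%SET.

Hypothesis irrM : irreducible_op.

Lemma op_ge0 w : (forall i, 0 <= w i) -> forall i, 0 <= op w i.
Proof. by move=> w0 i; apply: sumr_ge0 => j _; apply: mulr_ge0. Qed.

Lemma le_op w z : (forall i, w i <= z i) -> forall i, op w i <= op z i.
Proof. by move=> wz i; apply: ler_sum => j _; apply: ler_wpM2l. Qed.

Lemma opZ t w i : op (fun j => t * w j) i = t * op w i.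
Proof. by rewrite /op mulr_sumr; apply: eq_bigr => j _; rewrite mulrCA. Qed.

Lemma opB w z i : op (fun j => w j - z j) i = op w i - op z i.
Proof. by rewrite /op -sumrB; apply: eq_bigr => j _; rewrite mulrBr. Qed.

Lemma opD w z i : op (fun j => w j + z j) i = op w i + op z i.
Proof. by rewrite /op -big_split; apply: eq_bigr => j _; rewrite mulrDr. Qed.

(** At an index [i] maximising [v / w] the inequality [v <= k * w] is an equality; applying the
    monotone operator and reading it at [i] compares [rho] with [t]. *)
Lemma collatz_wielandt_le rho v w t : (0 < l)%N ->
  (forall i, 0 < v i) -> (forall i, op v i = rho * v i) ->
  (forall i, 0 < w i) -> (forall i, op w i <= t * w i) -> rho <= t.
Proof.
move=> l0 v0 Mv w0 Mw.
have [i Hi] := argmax_exists (fun i => v i / w i) (Ordinal l0).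
set k := v i / w i in Hi.
have k0 : 0 < k by rewrite divr_gt0.
have vk j : v j <= k * w j by rewrite -ler_pdivrMr.
have : op v i <= op (fun j => k * w j) i by exact: le_op.
rewrite opZ Mv => /le_trans /(_ (ler_wpM2l (ltW k0) (Mw i))).
rewrite mulrCA {1}/k divfK ?gt_eqF // ler_pM2r //.
Qed.

Lemma collatz_wielandt_ge rho v w t : (0 < l)%N -> 0 < rho ->
  (forall i, 0 < v i) -> (forall i, op v i = rho * v i) ->
  (forall i, 0 < w i) -> (forall i, t * w i <= op w i) -> t <= rho.
Proof.
move=> l0 rho0 v0 Mv w0 Mw.
have [i Hi] := argmax_exists (fun i => w i / v i) (Ordinal l0).
set k := w i / v i in Hi.
have k0 : 0 < k by rewrite divr_gt0.
have wk j : w j <= k * v j by rewrite -ler_pdivrMr.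
have : op w i <= op (fun j => k * v j) i by exact: le_op.
rewrite opZ Mv => /(le_trans (Mw i)).
rewrite mulrCA {1}/k divfK ?gt_eqF // ler_pM2r //.
Qed.

Let s w : 'I_l -> R := fun i => w i + op w i.

Lemma iter_s_ge0 n w : (forall i, 0 <= w i) -> forall i, 0 <= iter n s w i.
Proof.
by move=> w0; elim: n => //= n IH i; rewrite addr_ge0 ?op_ge0.
Qed.

Lemma iter_s_le n w z : (forall i, w i <= z i) ->
  forall i, iter n s w i <= iter n s z i.
Proof.
by move=> wz; elim: n => //= n IH i; rewrite lerD ?le_op.
Qed.

Lemma iter_sZ n t w i : iter n s (fun j => t * w j) i = t * iter n s w i.
Proof.
elim: n i => //= n IH i; rewrite /s mulrDr IH; congr (_ + _).
by rewrite -opZ; apply: eq_bigr => j _; rewrite IH.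
Qed.

Lemma iter_s_op n w i : iter n s (op w) i = op (iter n s w) i.
Proof.
elim: n i => //= n IH i; rewrite {1}/s opD IH; congr (_ + _).
by apply: eq_bigr => j _; rewrite IH.
Qed.

Lemma iter_sB n w z i :
  iter n s (fun j => w j - z j) i = iter n s w i - iter n s z i.
Proof.
elim: n i => //= n IH i; rewrite /s IH opprD addrACA; congr (_ + _).
by rewrite -opB; apply: eq_bigr => j _; rewrite IH.
Qed.

(** The support of the iterates of [I + M] never shrinks, and irreducibility makes it grow strictly
    until it is full, so [l] iterations suffice. *)
Lemma iter_s_gt0 z j : (forall i, 0 <= z i) -> 0 < z j ->
  forall i, 0 < iter l s z i.
Proof.
move=> z0 zj.
pose A n := [set i | 0 < iter n s z i]%SET.
have Ane n : A n != finset.set0.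
  apply/finset.set0Pn; exists j; elim: n => [|n]; rewrite !inE //= => H.
  by rewrite /s ltr_wpDr // op_ge0 //; exact: iter_s_ge0.
have card n : (n <= l -> n <= #|A n|)%N.
  elim: n => // n IH nl.
  have sub : A n \subset A n.+1.
    apply/fintype.subsetP => i; rewrite !inE /= => H.
    by rewrite /s ltr_wpDr // op_ge0 //; exact: iter_s_ge0.
  have [AT|AT] := eqVneq (A n) [set: 'I_l]%SET.
    by rewrite (leq_trans nl) // (leq_trans _ (subset_leq_card sub)) // AT finset.cardsT card_ord.
  suff: A n \proper A n.+1 by move/proper_card; apply: leq_ltn_trans; apply/IH/ltnW.
  (* If the support stopped growing before being full, its complement would be closed under [M],
     hence everything, although the support is nonempty. *)
  rewrite finset.properEneq sub andbT; apply/eqP => E.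
  have ACne : (~: A n != finset.set0)%SET by rewrite -finset.setCT (inj_eq (@finset.setC_inj _)).
  have : (~: A n = [set: 'I_l])%SET.
    apply: irrM => // i k.
    rewrite {1}E !inE negbK /= => Hi Hk.
    have /eqP : op (iter n s z) i = 0.
      apply/eqP; rewrite eq_le op_ge0 ?andbT; last exact: iter_s_ge0.
      apply: le_trans (_ : s (iter n s z) i <= 0); last by rewrite leNgt.
      by rewrite /s lerDr; exact: iter_s_ge0.
    rewrite psumr_eq0; last by move=> h _; rewrite mulr_ge0 //; exact: iter_s_ge0.
    by move=> /allP/(_ k (mem_index_enum _)); rewrite mulf_eq0 (gt_eqF Hk) orbF => /eqP.
  move=> /(congr1 (@finset.setC _)); rewrite finset.setCK finset.setCT => H.
  by move: (Ane n); rewrite H eqxx.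
move=> i; have : A l = [set: 'I_l]%SET.
  by apply/eqP; rewrite finset.eqEcard finset.subsetT finset.cardsT card_ord card.
by move=> /finset.setP/(_ i); rewrite !inE.
Qed.

(** The pair comes from minimising the Collatz--Wielandt quotient [max_i (op w i / w i)] over
    positive vectors: at a minimiser all the quotients must coincide. *)
Lemma perron_frobenius : (1 < l)%N ->
  exists rho v, [/\ 0 < rho, forall i : 'I_l, 0 < v i &
    forall i, op v i = rho * v i].
Proof.
move=> l1.
have i0 : 'I_l by exact: (Ordinal (ltnW l1)).
(* A zero row would make a single state closed, which irreducibility and [l > 1] exclude. *)
have op_gt0 w : (forall i, 0 < w i) -> forall i, 0 < op w i.
  move=> w0 i; rewrite lt_neqAle op_ge0 ?andbT; last by move=> k; exact: ltW.
  apply/eqP => /esym/eqP; rewrite psumr_eq0; last by move=> h _; rewrite mulr_ge0 // ltW.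
  move=> /allP H.
  have : [set i]%SET = [set: 'I_l]%SET.
    apply: irrM; first by apply/finset.set0Pn; exists i; rewrite inE.
    move=> a k; rewrite inE => /eqP -> _.
    by have := H k (mem_index_enum _); rewrite mulf_eq0 (gt_eqF (w0 k)) orbF => /eqP.
  by move/(congr1 (fun A : {set 'I_l} => #|A|)); rewrite cards1 finset.cardsT card_ord => E; rewrite -E in l1.
(* [t1] bounds the quotient of the constant vector, so only vectors with quotient at most [t1]
   compete for the minimum. *)
have [t1 t10 Ht1] : exists2 t1, 0 < t1 & forall i, op (fun=> 1) i <= t1 by exact: fin_ub.
pose e (j : 'I_l) : 'I_l -> R := fun i => (i == j)%:R.
have [eta eta0 Heta] : exists2 c, 0 < c &
    forall x : 'I_l * 'I_l, c <= iter l s (e x.2) x.1.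
  apply: fin_pos_lb => -[i j] /=; apply: (@iter_s_gt0 _ j).
    by move=> k; rewrite /e ler0n.
  by rewrite /e eqxx.
pose D := (1 + t1) ^+ l.
have D0 : 0 < D by rewrite exprn_gt0 // addr_gt0.
(* confines the minimisation of [max_i op w i / w i] to a compact box *)
have lower w : (forall i, 0 < w i) -> (forall i, op w i <= t1 * w i) ->
    forall i j, eta / D * w j <= w i.
  move=> w0 Hw i j.
  (* At every state, [(I + M) ^ l] applied to [w] is at most [D * w]; it is also at least [w j]
     times the image of the basis vector [e j], hence at least [eta * w j]. *)
  have up n k : iter n s w k <= (1 + t1) ^+ n * w k.
    elim: n k => [|n IH] k; first by rewrite expr0 mul1r.
    rewrite iterS /s exprS mulrDl mul1r mulrDl lerD //.
    rewrite (le_trans (le_op IH k)) // opZ -mulrA mulrCA ler_pM2l //.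
    by rewrite exprn_gt0 // addr_gt0.
  rewrite mulrAC ler_pdivrMr // [w i * D]mulrC (le_trans _ (up l i)) //.
  apply: le_trans (_ : iter l s (fun k => w j * e j k) i <= _).
    by rewrite iter_sZ mulrC ler_pM2l //; exact: (Heta (i, j)).
  apply: iter_s_le => k; rewrite /e; case: eqP => [->|_]; first by rewrite mulr1.
  by rewrite mulr0 ltW.
(* Positive vectors are written as [exp u] and normalised at [i0]; the bound [lower] then keeps the
   coordinates of [u] between [- B] and [B]. *)
pose B := ln (D / eta).
pose K := [set u : 'rV[R]_l | forall i, `[- B, B]%classic (u ord0 i)].
have cK : compact K by apply: (rV_compact (fun=> @segment_compact _ _ _)).
pose f (u : 'rV[R]_l) :=
  \big[Num.max/0]_(i <- enum 'I_l) \sum_j M i j * expR (u ord0 j - u ord0 i).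
have cf : continuous f.
  apply: continuous_big => [|i _]; first exact: (@max_continuous _ R).
  apply: continuous_big => [|j _ u]; first exact: add_continuous.
  have cB : (fun w : 'rV[R]_l => w ord0 j - w ord0 i) @ u --> u ord0 j - u ord0 i.
    by apply: (@cvgB _ _ _ (nbhs u)); exact: (@coord_continuous R).
  by apply: (@cvgMr _ _ (nbhs u)); exact: (cvg_comp _ _ cB (@continuous_expR R _)).
have fop (u : 'rV[R]_l) i : \sum_j M i j * expR (u ord0 j - u ord0 i) =
   op (fun j => expR (u ord0 j)) i / expR (u ord0 i).
  by rewrite mulr_suml; apply: eq_bigr => j _; rewrite expRB mulrA.
have f_ge (u : 'rV[R]_l) i : op (fun j => expR (u ord0 j)) i <= f u * expR (u ord0 i).
  rewrite -ler_pdivrMr ?expR_gt0 // -fop /f.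
  by apply: (@le_bigmax_seq _ _ _ _ 0 i) => //; rewrite mem_enum.
have f_le (u : 'rV[R]_l) t : (forall i, op (fun j => expR (u ord0 j)) i <= t * expR (u ord0 i)) -> f u <= t.
  move=> H; rewrite /f; apply: bigmax_le => [|i _].
    have := H i0; rewrite -ler_pdivrMr ?expR_gt0 //; apply: le_trans.
    by rewrite divr_ge0 ?expR_ge0 // op_ge0 // => ?; exact: expR_ge0.
  by rewrite fop ler_pdivrMr ?expR_gt0.
have eta_le : eta <= D.
  have H : forall i, op (fun=> 1) i <= t1 * (fun=> 1) i by move=> i; rewrite mulr1.
  by have := lower (fun=> 1) (fun=> ltr01) H i0 i0; rewrite mulr1 ler_pdivrMr // mul1r.
have B0 : 0 <= B by rewrite ln_ge0 // ler_pdivlMr // mul1r.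
have K0 : K !=set0.
  by exists 0 => i; rewrite mxE /= in_itv /= oppr_le0 B0.
have [u uK umin] := compact_EVT_min K0 cK (continuous_subspaceT cf).
pose r := f u.
pose v i := expR (u ord0 i).
have v0 i : 0 < v i by exact: expR_gt0.
have Mv i : op v i <= r * v i by exact: f_ge.
have r_le w t : (forall i, 0 < w i) -> (forall i, op w i <= t * w i) -> r <= t.
  move=> w0 Hw; have [t1t|tt1] := leP t1 t.
    apply: le_trans t1t; apply: le_trans (_ : f 0 <= t1).
      by apply: umin; rewrite inE => i; rewrite mxE /= in_itv /= oppr_le0 B0.
    apply: f_le => i; rewrite mxE expR0 mulr1 (le_trans _ (Ht1 i)) //.
    by apply: le_op => j; rewrite mxE expR0.
  have Hw1 i : op w i <= t1 * w i by rewrite (le_trans (Hw i)) // ler_pM2r // ltW.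
  have low := lower w w0 Hw1.
  pose u' : 'rV[R]_l := \row_i ln (w i / w i0).
  have Eu i : expR (u' ord0 i) = (w i0)^-1 * w i.
    by rewrite mxE lnK ?posrE ?divr_gt0 // mulrC.
  apply: le_trans (_ : f u' <= t).
    apply: umin; rewrite inE => i /=; rewrite in_itv /= mxE.
    apply/andP; split; last first.
      rewrite ler_ln ?posrE ?divr_gt0 // ler_pdivrMr // mulrC -ler_pdivrMr ?divr_gt0 //.
      by rewrite invf_div mulrC.
    rewrite -lnV ?posrE ?divr_gt0 // ler_ln ?posrE ?invr_gt0 ?divr_gt0 //.
    by rewrite ler_pdivlMr // invf_div.
  apply: f_le => i; rewrite Eu mulrCA.
  rewrite (_ : op _ i = op (fun j => (w i0)^-1 * w j) i); last first.
    by apply: eq_bigr => j _; rewrite Eu.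
  by rewrite opZ ler_pM2l ?invr_gt0.
have r0 : 0 < r.
  have := lt_le_trans (op_gt0 v v0 i0) (Mv i0).
  by rewrite pmulr_lgt0.
exists r, v; split => // i; apply/eqP; rewrite eq_le Mv /= leNgt; apply/negP => Hlt.
(* The defect [z] is nonnegative and positive at [i], so [(I + M) ^ l] makes it positive everywhere.
   That map commutes with [M], so [v'] has all its quotients strictly below the minimum [r]. *)
pose z j := r * v j - op v j.
have z0 j : 0 <= z j by rewrite subr_ge0.
have zi : 0 < z i by rewrite subr_gt0.
have z'0 := iter_s_gt0 z0 zi.
pose v' := iter l s v.
have v'0 : forall j, 0 < v' j.
  by apply: (@iter_s_gt0 _ i) => // j; exact: ltW.
have Mv' j : op v' j < r * v' j.
  rewrite -subr_gt0 /v' -iter_s_op -iter_sZ -iter_sB; exact: z'0.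
have [t Ht] := argmax_exists (fun j => op v' j / v' j) i0.
have : r <= op v' t / v' t.
  by apply: (r_le v') => // j; rewrite -ler_pdivrMr.
by rewrite leNgt ltr_pdivrMr ?Mv'.
Qed.

End nonnegative_operator.

(** * Poisson equation and perturbation of Perron pairs *)

Section perron_family.
Context {R : realType} {l : nat}.
Implicit Types (Q : 'I_l -> 'I_l -> R).

Lemma irreducible_op_sub Q Q' : irreducible_op Q ->
  (forall i j, Q' i j = 0 -> Q i j = 0) -> irreducible_op Q'.
Proof. by move=> irr Q'Q A A0 cA; apply: irr => // i j iA jA; exact/Q'Q/cA. Qed.

(** Paths starting in a closed set stay in it, so every power of [P] vanishes on the entries leading
    out. *)
Lemma irreducible_mx_op (P : 'M[R]_l) : irreducible_mx P -> irreducible_op P.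
Proof.
move=> irr A /finset.set0Pn[i0 i0A] cA; apply/finset.setP => j; rewrite finset.in_setT.
apply/negPn/negP => jA.
have [n [_]] := irr i0 j.
suff -> : (P ^+ n) i0 j = 0 by rewrite ltxx.
elim: n i0 i0A => [|n IH] i iA.
  by rewrite expr0 mxE; case: eqP => // E; rewrite -E iA in jA.
rewrite exprS mxE big1 // => k _; have [kA|kA] := boolP (k \in A).
  by rewrite IH // mulr0.
by rewrite (cA i k) // mul0r.
Qed.

(** Imposing [c = x i0] makes the system square. Its kernel is trivial by the maximum principle:
    comparing at a maximum and at a minimum gives [u i0 = 0], and then the set of maximisers is
    closed, so [u] is constant. *)
Lemma poisson_equation Q (b : 'I_l -> R) : (0 < l)%N ->
  (forall i j, 0 <= Q i j) -> (forall i, \sum_j Q i j = 1) ->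
  irreducible_op Q ->
  exists (c : R) (x : 'I_l -> R), forall i, b i + op Q x i = c + x i.
Proof.
move=> l0 Q0 Q1 irr; pose i0 := Ordinal l0.
pose A : 'M[R]_l := \matrix_(j, i) ((i == j)%:R - Q i j + (j == i0)%:R).
have AE (u : 'rV[R]_l) i :
    (u *m A) ord0 i = u ord0 i - op Q (u ord0) i + u ord0 i0.
  rewrite mxE /op.
  under eq_bigr do rewrite mxE mulrDr mulrBr.
  rewrite big_split sumrB /=; congr (_ - _ + _).
  - rewrite (bigD1 i) //= eqxx mulr1 big1 ?addr0 // => j.
    by rewrite eq_sym => /negbTE ->; rewrite mulr0.
  - by apply: eq_bigr => j _; rewrite mulrC.
  - rewrite (bigD1 i0) //= mulr1 big1 ?addr0 // => j.
    by move=> /negbTE ->; rewrite mulr0.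
have uA : A \in unitmx.
  rewrite -row_free_unit; apply: inj_row_free => u /rowP uA0.
  have E i : op Q (u ord0) i = u ord0 i + u ord0 i0.
    by have := uA0 i; rewrite AE !mxE => ?; lra.
  have avg i (t : R) : op Q (fun=> t) i = t by rewrite /op -mulr_suml Q1 mul1r.
  have [i imax] := argmax_exists (u ord0) i0.
  have [k kmin] := argmin_exists (u ord0) i0.
  have ui0 : u ord0 i0 = 0.
    have := le_op Q0 imax i; have := le_op Q0 kmin k.
    by rewrite !avg !E => ? ?; lra.
  have : [set j | u ord0 j == u ord0 i]%SET = [set: 'I_l]%SET.
    apply: irr; first by apply/finset.set0Pn; exists i; rewrite inE.
    move=> j h; rewrite !inE => /eqP uj uh.
    have : \sum_a Q j a * (u ord0 i - u ord0 a) == 0.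
      under eq_bigr do rewrite mulrBr.
      by rewrite sumrB -mulr_suml Q1 mul1r -/(op Q (u ord0) j) E ui0 uj addr0 subrr.
    rewrite psumr_eq0; last by move=> a _; rewrite mulr_ge0 ?subr_ge0.
    move=> /allP/(_ h (mem_index_enum _)); rewrite mulf_eq0 subr_eq0.
    by rewrite [_ == u ord0 h]eq_sym (negbTE uh) orbF => /eqP.
  move=> /finset.setP H; apply/rowP => j; rewrite mxE -ui0.
  have := H j; have := H i0; rewrite !inE => /eqP -> /eqP ->//.
exists (((\row_i b i) *m invmx A) ord0 i0), (((\row_i b i) *m invmx A) ord0).
move=> i; have := AE ((\row_i b i) *m invmx A) i.
by rewrite mulmxKV // mxE => ?; lra.
Qed.

Lemma expR_le_quad (z : R) : `|z| <= 2^-1 -> expR z <= 1 + z + 2 * z ^+ 2.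
Proof.
move=> hz; have := expR_ge1Dx (- z); rewrite expRN => h.
have [h1 h2] : - 2^-1 <= z /\ z <= 2^-1 by move: hz; rewrite ler_norml => /andP[].
have e0 := expR_gt0 z.
have : (1 - z) * expR z <= 1.
  by rewrite -ler_pdivlMr // mul1r.
nra.
Qed.

(** Real power with [0 ^ q = 0] for every [q], including [q <= 0], as the structure function
    requires; it is multiplicative on nonnegative numbers. *)
Definition pw (x q : R) : R := if x == 0 then 0 else expR (q * ln x).

Lemma pw_ge0 x q : 0 <= pw x q.
Proof. by rewrite /pw; case: ifP => // _; exact: expR_ge0. Qed.

Lemma pw0 q : pw 0 q = 0. Proof. by rewrite /pw eqxx. Qed.

Lemma pwE x q : 0 < x -> pw x q = expR (q * ln x).
Proof. by rewrite /pw => /gt_eqF ->. Qed.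

Lemma pw_gt0 x q : 0 < x -> 0 < pw x q.
Proof. by move=> /pwE ->; exact: expR_gt0. Qed.

Lemma pw_eq0 x q : pw x q = 0 -> x = 0.
Proof. by rewrite /pw; case: eqP => // _ /eqP; rewrite gt_eqF // expR_gt0. Qed.

Lemma pwM x y q : 0 <= x -> 0 <= y -> pw (x * y) q = pw x q * pw y q.
Proof.
rewrite !le_eqVlt => /orP[/eqP<-|x0]; first by rewrite mul0r pw0 mul0r.
move=> /orP[/eqP<-|y0]; first by rewrite mulr0 pw0 mulr0.
by rewrite !pwE ?mulr_gt0 // lnM ?posrE // mulrDr expRD.
Qed.

Definition pmx (P : 'M[R]_l) q : 'I_l -> 'I_l -> R := fun i j => pw (P i j) q.

Definition perron_pair (P : 'M[R]_l) q rho v :=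
  [/\ 0 < rho, forall i : 'I_l, 0 < v i &
    forall i, op (pmx P q) v i = rho * v i].

Variable P : 'M[R]_l.
Hypotheses (l1 : (1 < l)%N) (P0 : forall i j, 0 <= P i j) (irrP : irreducible_mx P).

Lemma irreducible_pmx q : irreducible_op (pmx P q).
Proof.
apply: (irreducible_op_sub (irreducible_mx_op irrP)) => i j; exact: pw_eq0.
Qed.

Lemma perron_pair_exists q : exists rho v, perron_pair P q rho v.
Proof.
by apply: perron_frobenius => //; [move=> i j; exact: pw_ge0|exact: irreducible_pmx].
Qed.

(* Perturbing the eigenvector [v] to [v * exp (h x)], where [x] solves the
   Poisson equation for the mean of [ln P], gives Collatz--Wielandt bounds on
   the eigenvalue at [q + h] that agree to first order; the lower one holds for
   all [h] by convexity of the exponential. *)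
Lemma ln_perron_tangent (q rho : R) v : perron_pair P q rho v ->
  exists c K h0 : R, 0 < h0 /\ forall h rho' v', perron_pair P (q + h) rho' v' ->
    h * c <= ln rho' - ln rho /\
    (`|h| <= h0 -> ln rho' - ln rho <= h * c + K * h ^+ 2).
Proof.
move=> [rho0 v0 Mv].
pose Q i j := pmx P q i j * v j / (rho * v i).
have rv i : 0 < rho * v i by rewrite mulr_gt0.
have Q0 i j : 0 <= Q i j.
  by rewrite /Q divr_ge0 ?mulr_ge0 ?pw_ge0 ?(ltW (v0 _)) // ltW.
have Q1 i : \sum_j Q i j = 1.
  by rewrite -mulr_suml -/(op (pmx P q) v i) Mv divff // gt_eqF.
have irrQ : irreducible_op Q.
  apply: (irreducible_op_sub (irreducible_pmx (q := q))) => i j /eqP.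
  by rewrite /Q !mulf_eq0 invr_eq0 (gt_eqF (rv i)) (gt_eqF (v0 j)) !orbF => /eqP.
have [c [x xc]] := poisson_equation (fun i => \sum_j Q i j * ln (P i j)) (ltnW l1) Q0 Q1 irrQ.
(* The coboundary [x j - x i] gives the logarithmic increments the same mean [c] in every row of
   [Q]. *)
pose y i j := ln (P i j) + x j - x i.
have Qy i : \sum_j Q i j * y i j = c.
  under eq_bigr do rewrite mulrBr mulrDr.
  by rewrite sumrB big_split /= -mulr_suml Q1 mul1r; have := xc i; rewrite /op => ->; ring.
have [Y Y0 HY] : exists2 Y, 0 < Y & forall a : 'I_l * 'I_l, `|y a.1 a.2| <= Y.
  exact: fin_ub.
(* The radius keeps every [h * y i j] within 1/2 in absolute value, the range where [expR_le_quad]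
   applies. *)
exists c, (2 * Y ^+ 2), (2 * Y)^-1; split; first by rewrite invr_gt0 mulr_gt0.
move=> h rho' v' [rho'0 v'0 Mv'].
pose w j := v j * expR (h * x j).
have w0 j : 0 < w j by rewrite mulr_gt0 ?expR_gt0.
have opw i : op (pmx P (q + h)) w i = (rho * \sum_j Q i j * expR (h * y i j)) * w i.
  rewrite mulrAC mulr_sumr; apply: eq_bigr => j _.
  rewrite /Q /pmx; have [->|Pij] := eqVneq (P i j) 0; first by rewrite !pw0 !mul0r mulr0.
  have {}Pij : 0 < P i j by rewrite lt_neqAle eq_sym Pij P0.
  rewrite !pwE // /w /y mulrDl mulrBr mulrDr expRB !expRD.
  by field; rewrite !gt_eqF ?expR_gt0.
have lnrho : ln rho' - ln rho = ln (rho' / rho) by rewrite ln_div ?posrE.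
rewrite lnrho; split.
  rewrite -ler_expR lnK ?posrE ?divr_gt0 // ler_pdivlMr // mulrC.
  apply: (@collatz_wielandt_ge _ _ _ _ _ _ w _ _ rho'0 v'0 Mv') => //.
    by move=> i j; exact: pw_ge0.
    exact: ltnW.
  move=> i; rewrite opw ler_pM2r // ler_pM2l //.
  rewrite -[leLHS]mulr1.
  (* Once [exp (h * c)] is factored out, what remains is at least [1 + h * (y - c)], whose mean
     under each row of [Q] is exactly 1. *)
  have -> : 1 = \sum_j Q i j * (1 + h * (y i j - c)).
    rewrite (eq_bigr (fun j => Q i j + (h * (Q i j * y i j) - h * c * Q i j))); last by move=> j _; ring.
    by rewrite big_split sumrB /= -!mulr_sumr Qy Q1; ring.
  rewrite mulr_sumr; apply: ler_sum => j _; rewrite mulrCA ler_wpM2l //.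
  have -> : h * y i j = h * c + h * (y i j - c) by ring.
  by rewrite expRD ler_pM2l ?expR_gt0 // expR_ge1Dx.
move=> hh0.
have : rho' <= rho * (1 + (h * c + 2 * Y ^+ 2 * h ^+ 2)).
  apply: (@collatz_wielandt_le _ _ _ _ _ _ w _ _ v'0 Mv') => //.
    by move=> i j; exact: pw_ge0.
    exact: ltnW.
  move=> i; rewrite opw ler_pM2r // ler_pM2l //.
  have -> : 1 + (h * c + 2 * Y ^+ 2 * h ^+ 2) =
      \sum_j Q i j * (1 + h * y i j + 2 * (h ^+ 2 * Y ^+ 2)).
    rewrite (eq_bigr (fun j => Q i j + (h * (Q i j * y i j) + (2 * (h ^+ 2 * Y ^+ 2)) * Q i j))); last by move=> j _; ring.
    by rewrite !big_split /= -!mulr_sumr Qy Q1; ring.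
  apply: ler_sum => j _; rewrite ler_wpM2l //.
  have yY := HY (i, j); rewrite /= in yY.
  apply: le_trans (expR_le_quad _) _.
    rewrite normrM (le_trans (ler_wpM2l (normr_ge0 _) yY)) //.
    by rewrite (le_trans (ler_wpM2r (ltW Y0) hh0)) // invfM -mulrA mulVf ?mulr1 // gt_eqF.
  rewrite lerD2l ler_pM2l // exprMn ler_wpM2l ?sqr_ge0 //.
  by rewrite -(real_normK (num_real (y i j))) lerXn2r ?nnegrE // ltW.
rewrite mulrC -ler_pdivrMr // => H.
apply: le_trans (_ : ln (1 + (h * c + 2 * Y ^+ 2 * h ^+ 2)) <= _).
  by rewrite ler_ln ?posrE ?divr_gt0 // (lt_le_trans _ H) // divr_gt0.
by apply: le_ln1Dx; have : 0 < rho' / rho; [rewrite divr_gt0|lra].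
Qed.

End perron_family.

(** * Supporting lines *)

Section exact_tangents.
Context {R : realType}.
Implicit Types (f : R -> R).

(* Convexity and differentiability at once: supporting lines that are exact up
   to a quadratic error. *)
Definition exact_tangents f := forall q, exists c K h0 : R, 0 < h0 /\
  forall h, h * c <= f (q + h) - f q /\
    (`|h| <= h0 -> f (q + h) - f q <= h * c + K * h ^+ 2).

(** The difference quotient is within [|K| * |h|] of [c] for small [h], so the slope of the
    supporting line is the derivative. *)
Lemma exact_tangents_is_derive f q : exact_tangents f ->
  exists c K h0 : R, is_derive q (1 : R) f c /\ 0 < h0 /\
  forall h, h * c <= f (q + h) - f q /\
    (`|h| <= h0 -> f (q + h) - f q <= h * c + K * h ^+ 2).
Proof.
move=> /(_ q)[c [K [h0 [h00 H]]]]; exists c, K, h0; split => //.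
have C : h^-1 *: (f (h *: (1 : R) + q) - f q) @[h --> (0 : R)^'] --> c.
  apply/cvgrPdist_le => e e0; near=> h.
  have hn0 : h != 0 by near: h; exact: nbhs_dnbhs_neq.
  have hh0 : `|h| <= h0 by near: h; exact: dnbhs0_le.
  have he : `|h| <= e / (`|K| + 1).
    by near: h; apply: dnbhs0_le; rewrite divr_gt0 // ltr_wpDl.
  have [H1 /(_ hh0) H2] := H h.
  have -> : h *: (1 : R) + q = q + h by rewrite addrC /GRing.scale /= mulr1.
  have -> : c - h^-1 *: (f (q + h) - f q) = - (h^-1 * (f (q + h) - f q - h * c)).
    by rewrite /GRing.scale /=; field.
  rewrite normrN normrM normfV ger0_norm; last by rewrite subr_ge0.
  rewrite ler_pdivrMl ?normr_gt0 //.
  have : f (q + h) - f q - h * c <= K * h ^+ 2 by lra.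
  move/le_trans; apply; rewrite -(real_normK (num_real h)).
  rewrite expr2 mulrCA ler_wpM2l //.
  move: he; rewrite ler_pdivlMr ?ltr_wpDl // => he.
  apply: le_trans he; rewrite mulrC ler_wpM2l //.
  by rewrite (le_trans (ler_norm _)) // lerDl.
by apply: DeriveDef; [exact: (cvgP c C)|exact: (cvg_lim _ C)].
Unshelve. all: by end_near.
Qed.

Lemma exact_tangents_derivable f q : exact_tangents f -> derivable f q (1 : R).
Proof. by move=> /exact_tangents_is_derive - /(_ q)[c [K [h0 [] ] ] ]. Qed.

Lemma exact_tangents_supporting f q h : exact_tangents f ->
  h * derive1 f q <= f (q + h) - f q.
Proof.
move=> /exact_tangents_is_derive - /(_ q)[c [K [h0 [fc [_ H]]]]].
by rewrite derive1E derive_val; exact: (H h).1.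
Qed.

Lemma exact_tangents_approx f q (e : R) : exact_tangents f -> 0 < e ->
  exists2 h0, 0 < h0 & forall h, `|h| <= h0 ->
    f (q + h) - f q <= h * derive1 f q + e * `|h|.
Proof.
move=> ft e0; have [c [K [h0 [fc [h00 H]]]]] := exact_tangents_is_derive q ft.
have Kp : 0 < `|K| + 1 by rewrite ltr_wpDl.
exists (Num.min h0 (e / (`|K| + 1))); first by rewrite lt_min h00 divr_gt0.
move=> h; rewrite le_min => /andP[hh0 he].
apply: le_trans ((H h).2 hh0) _; rewrite derive1E derive_val lerD2l.
rewrite -(real_normK (num_real h)) expr2 mulrA ler_wpM2r //.
move: he; rewrite ler_pdivlMr // mulrC; apply: le_trans.
by rewrite ler_wpM2r // (le_trans (ler_norm _)) // lerDl.
Qed.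

Lemma exact_tangents_derive_mono f : exact_tangents f ->
  {homo (derive1 f) : x y / x <= y}.
Proof.
move=> ft x y; rewrite le_eqVlt => /orP[/eqP->//|xy].
have := exact_tangents_supporting x (y - x) ft.
have := exact_tangents_supporting y (x - y) ft.
rewrite !subrKC => H1 H2; have : (y - x) * derive1 f x <= (y - x) * derive1 f y by lra.
by rewrite ler_pM2l // subr_gt0.
Qed.

(** The limits of the monotone derivative are its supremum and infimum, so it takes values on both
    sides of [- a]. Between two such points [f q + a * q] has an interior minimum, where its
    derivative vanishes. *)
Lemma exact_tangents_slope f (a : R) : exact_tangents f ->
  (- lim ((derive1 f q)%:E @[q --> +oo%R]) < a%:E)%E ->
  (a%:E < - lim ((derive1 f q)%:E @[q --> -oo%R]))%E ->
  exists q, derive1 f q = - a.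
Proof.
move=> ft; have mono := exact_tangents_derive_mono ft.
have c1 : (derive1 f q)%:E @[q --> +oo%R] --> ereal_sup (range (fun q => (derive1 f q)%:E)).
  by apply: nondecreasing_cvge => x y xy; rewrite lee_fin mono.
have c2 : (derive1 f q)%:E @[q --> -oo%R] --> ereal_inf (range (fun q => (derive1 f (- q))%:E)).
  apply/cvgNy_compNP; apply: nonincreasing_cvge => x y xy.
  by rewrite /= lee_fin mono // lerN2.
rewrite (cvg_lim _ c1) // (cvg_lim _ c2) // lteNl -EFinN => /ereal_sup_gt[_ [q1 _ <-]].
rewrite lteNr -EFinN => H1 /ereal_inf_lt[_ [q2 _ <-]]; rewrite !lte_fin in H1 *.
move: (- q2) => {}q2 H2.
have q21 : q2 < q1.
  by rewrite ltNge; apply/negP => /mono H; have := lt_le_trans H2 (ltW H1); rewrite ltNge H.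
pose g q := f q + a * q.
have dg q : is_derive q (1 : R) g (derive1 f q + a).
  have := @exact_tangents_derivable f q ft => /derivableP fd.
  rewrite /g -[X in derive1 f q + X]mulr1 derive1E.
  by apply: is_deriveD; apply: is_deriveZ.
have cg : {within `[q2, q1], continuous g}.
  by apply: derivable_within_continuous => q _; exact: ex_derive.
have [c cI gc] := EVT_min (ltW q21) cg.
have gt q h : h * (derive1 f q + a) <= g (q + h) - g q.
  by have := exact_tangents_supporting q h ft; rewrite /g => ?; lra.
have ga q e : 0 < e -> exists2 h0, 0 < h0 & forall h, `|h| <= h0 ->
    g (q + h) - g q <= h * (derive1 f q + a) + e * `|h|.
  move=> e0; have [h0 h00 H] := exact_tangents_approx q ft e0.
  by exists h0 => // h /H; rewrite /g => ?; lra.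
(* To first order [g] decreases inwards from both endpoints; an error [e] equal to half the size of
   the slope still leaves a strict decrease over a short step, so neither endpoint is a minimum. *)
have cI' : c \in `]q2, q1[.
  move: (cI); rewrite !in_itv /= => /andP[q2c cq1].
  rewrite !lt_neqAle q2c cq1 !andbT; apply/andP; split; apply/eqP => E.
    have e0 : 0 < - (derive1 f q2 + a) / 2 by rewrite divr_gt0 // ltrNr oppr0; lra.
    have [h0 h00 H] := ga q2 _ e0.
    pose h := Num.min h0 (q1 - q2).
    have hp : 0 < h by rewrite lt_min h00 subr_gt0.
    have := H h; rewrite gtr0_norm // ge_min lexx => /(_ isT) Hh.
    have := gc (q2 + h); rewrite in_itv /= lerDl ltW //= -lerBrDl ge_min lexx orbT => /(_ isT).
    by rewrite -E; nra.
  have e0 : 0 < (derive1 f q1 + a) / 2 by rewrite divr_gt0 //; lra.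
  have [h0 h00 H] := ga q1 _ e0.
  pose h := Num.min h0 (q1 - q2).
  have hp : 0 < h by rewrite lt_min h00 subr_gt0.
  have := H (- h); rewrite normrN gtr0_norm // ge_min lexx => /(_ isT) Hh.
  have := gc (q1 - h); rewrite in_itv /= gerBl (ltW hp) andbT lerBrDl -lerBrDr ge_min lexx orbT => /(_ isT).
  by rewrite E; nra.
have D0 : is_derive c (1 : R) g 0.
  apply: (derive1_at_min (ltW q21) _ cI') => t tI; first exact: ex_derive.
  by apply: gc; move: tI; rewrite !in_itv /= => /andP[/ltW -> /ltW ->].
exists c; have := @derive_val _ _ _ _ _ _ _ D0.
by rewrite (@derive_val _ _ _ _ _ _ _ (dg c)) => ?; lra.
Qed.

End exact_tangents.

(** * Adic intervals *)

Section adic_intervals.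
Context {l : nat}.
Implicit Types (s : seq 'I_l).

(** Base-[l] value of the word, first letter most significant: the rank from the left, counted from
    0, of its interval among those of the same order. *)
Definition idx s : nat := foldl (fun a (d : 'I_l) => (a * l + d)%N) 0%N s.

Lemma idx_rcons s d : idx (rcons s d) = (idx s * l + d)%N.
Proof. by rewrite /idx foldl_rcons. Qed.

Lemma idx_cons d s : idx (d :: s) = (d * l ^ size s + idx s)%N.
Proof.
elim/last_ind: s => [|s e IH]; first by rewrite /idx /= muln1 addn0.
by rewrite -rcons_cons !idx_rcons IH size_rcons expnSr mulnDl mulnA addnA.
Qed.

Lemma idx_lt s : (idx s < l ^ size s)%N.
Proof.
elim/last_ind: s => [|s e IH]; first by rewrite expn0.
rewrite idx_rcons size_rcons expnSr; apply: leq_trans (_ : (idx s).+1 * l <= _)%N.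
  by rewrite mulSn addnC ltn_add2r.
by rewrite leq_mul2r IH orbT.
Qed.

Lemma idx_inj s s' : size s = size s' -> idx s = idx s' -> s = s'.
Proof.
elim/last_ind: s s' => [|s e IH] s'; first by case: s'.
case/lastP: s' => [|s' e']; rewrite ?size_rcons // => -[ss]; rewrite !idx_rcons => E.
have l0 : (0 < l)%N by exact: leq_ltn_trans (ltn_ord e).
have Ee : e = e'.
  apply: val_inj; have := congr1 (modn^~ l) E.
  by rewrite /= !modnMDl !modn_small.
rewrite -Ee in E *; congr rcons; apply: IH => //.
by move/eqP: E; rewrite eqn_add2r eqn_pmul2r // => /eqP.
Qed.

Lemma idx_surj n k : (k < l ^ n)%N -> exists w : n.-tuple 'I_l, idx w = k.
Proof.
elim: n k => [|n IH] k.
  by rewrite expn0 ltnS leqn0 => /eqP ->; exists [tuple].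
move=> kl; have l0 : (0 < l)%N by case: (l) kl => //; rewrite exp0n.
have kd : (k %/ l < l ^ n)%N by rewrite ltn_divLR // -expnSr.
have [w wk] := IH _ kd; exists [tuple of rcons w (Ordinal (ltn_pmod k l0))].
by rewrite idx_rcons wk -divn_eq.
Qed.

Context {R : realType}.
Implicit Types (y : R).

Lemma cylinder_leftE n (w : n.-tuple 'I_l) :
  cylinder_left R w = (idx w)%:R * l%:R ^- n.
Proof.
rewrite /cylinder_left; elim: n w => [|n IH] w.
  by rewrite big_ord0 tuple0 /idx /= mul0r.
case/tupleP: w => d w; rewrite big_ord_recl tnth0 idx_cons (size_tuple w).
have l0 : l%:R != 0 :> R by rewrite pnatr_eq0 -lt0n (leq_ltn_trans _ (ltn_ord d)).
rewrite (eq_bigr (fun i : 'I_n => ((tnth w i)%:R * l%:R ^- i.+1) / l%:R)); last first.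
  by move=> i _; rewrite tnthS lift0 exprSr invfM mulrA.
rewrite -mulr_suml IH natrD natrM natrX /= expr1 exprS.
by field; rewrite l0 expf_neq0.
Qed.

Lemma in_cylinder n (w : n.-tuple 'I_l) y : (0 < l)%N ->
  cylinder R w y <-> (idx w)%:R <= y * l%:R ^+ n < (idx w).+1%:R.
Proof.
move=> l0; have ln0 : 0 < l%:R ^+ n :> R by rewrite exprn_gt0 // ltr0n.
rewrite /cylinder /= in_itv /= cylinder_leftE.
have -> : (idx w)%:R * l%:R ^- n + l%:R ^- n = (idx w).+1%:R * l%:R ^- n :> R.
  by rewrite -natr1 mulrDl mul1r.
by rewrite ler_pdivrMr // ltr_pdivlMr.
Qed.

Lemma cylinder_exists n y : (0 < l)%N -> 0 <= y < 1 ->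
  exists w : n.-tuple 'I_l, cylinder R w y.
Proof.
move=> l0 /andP[y0 y1]; have ln0 : 0 < l%:R ^+ n :> R by rewrite exprn_gt0 // ltr0n.
have yl0 : 0 <= y * l%:R ^+ n by rewrite mulr_ge0 // ltW.
have [|w wk] := @idx_surj n (Num.truncn (y * l%:R ^+ n)).
  by rewrite truncn_lt_nat // natrX gtr_pMl.
by exists w; rewrite in_cylinder // wk truncn_itv.
Qed.

Lemma truncn_cylinder n (w : n.-tuple 'I_l) y : (0 < l)%N -> cylinder R w y ->
  Num.truncn (y * l%:R ^+ n) = idx w.
Proof. by move=> l0 /in_cylinder - /(_ l0)/truncn_def. Qed.

Lemma cylinder_unique n (w w' : n.-tuple 'I_l) y : (0 < l)%N ->
  cylinder R w y -> cylinder R w' y -> w = w'.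
Proof.
move=> l0 /(truncn_cylinder l0) E /(truncn_cylinder l0) E'.
by apply: val_inj; apply: idx_inj; rewrite ?size_tuple // -E -E'.
Qed.

Lemma cylinder_sub01 n (w : n.-tuple 'I_l) y : (0 < l)%N ->
  cylinder R w y -> 0 <= y < 1.
Proof.
move=> l0 /in_cylinder - /(_ l0)/andP[wy yw].
have ln0 : 0 < l%:R ^+ n :> R by rewrite exprn_gt0 // ltr0n.
apply/andP; split; first by rewrite -(pmulr_lge0 _ ln0) (le_trans _ wy).
rewrite -(ltr_pM2r ln0) mul1r (lt_le_trans yw) // -natrX ler_nat.
by have := idx_lt w; rewrite size_tuple.
Qed.

Lemma cylinder_neq0 n (w : n.-tuple 'I_l) : (0 < l)%N -> cylinder R w !=set0.
Proof.
move=> l0; exists (cylinder_left R w); rewrite /cylinder /= in_itv /= lexx /=.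
by rewrite ltrDl invr_gt0 exprn_gt0 // ltr0n.
Qed.

Lemma cylinder_inj n : (0 < l)%N -> injective (fun w : n.-tuple 'I_l => cylinder R w).
Proof.
move=> l0 w w' E; have [y wy] := cylinder_neq0 w l0.
by apply: (cylinder_unique l0 wy); rewrite -E.
Qed.

Lemma adic_atE n (w : n.-tuple 'I_l) y : (0 < l)%N -> cylinder R w y ->
  adic_at l n y = cylinder R w.
Proof.
move=> l0 wy; apply: xget_unique; first by split => //; exists w.
by move=> _ [[w' _ <-] w'y]; rewrite (cylinder_unique l0 wy w'y).
Qed.

Lemma sum_adic n (F : set R -> R) : (0 < l)%N ->
  \sum_(I \in adic R l n) F I = \sum_(w : n.-tuple 'I_l) F (cylinder R w).
Proof.
move=> l0; rewrite /adic fsbig_image; last by move=> w w' _ _; exact: cylinder_inj.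
rewrite -big_enum /= [RHS]fsbig_seq ?enum_uniq //.
by rewrite (_ : [set` enum _] = [set: n.-tuple 'I_l]) //; apply/seteqP; split=> w //= _; rewrite mem_enum.
Qed.

Lemma lebesgue_cylinder n (w : n.-tuple 'I_l) : (0 < l)%N ->
  lebesgue_measure (cylinder R w) = (l%:R ^- n)%:E.
Proof.
move=> l0; rewrite /cylinder lebesgue_measure_itv /= lte_fin ltrDl invr_gt0.
by rewrite exprn_gt0 ?ltr0n // -EFinB addrC addKr.
Qed.

Lemma le_diam (U : set R) x y : U x -> U y -> (`|x - y|%:E <= diam U)%E.
Proof. by move=> Ux Uy; apply: ereal_sup_ubound; exists (x, y). Qed.

Lemma diam_cylinder n (w : n.-tuple 'I_l) : (diam (cylinder R w) <= (l%:R ^- n)%:E)%E.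
Proof.
apply: ge_ereal_sup => _ [[x y] [/= wx wy] <-]; rewrite lee_fin.
move: wx wy; rewrite /cylinder /= !in_itv /= => /andP[x1 x2] /andP[y1 y2].
by rewrite ler_norml; apply/andP; split; lra.
Qed.

(** Two points of [U] differ by at most one interval length, so the ranks of the intervals met
    differ by at most 1 from that of any fixed one. *)
Lemma card_cylinders_meeting n (U : set R) : (0 < l)%N ->
  (diam U <= (l%:R ^- n)%:E)%E ->
  (#|[set w : n.-tuple 'I_l | `[< exists2 y, U y & cylinder R w y >] ]%SET| <= 3)%N.
Proof.
move=> l0 dU; set S := [set _ | _]%SET.
have [->|/finset.set0Pn[w0]] := eqVneq S finset.set0; first by rewrite finset.cards0.
rewrite inE => /asboolP[y0 Uy0 wy0]; pose k := idx w0.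
have ln0 : 0 < l%:R ^+ n :> R by rewrite exprn_gt0 // ltr0n.
(* For [k = 0] the list repeats 0, which is harmless since only its length is used as an upper
   bound. *)
rewrite cardE; apply: (@leq_trans (size [:: k.-1; k; k.+1])) => //.
rewrite -(size_map (fun w : n.-tuple 'I_l => idx w)); apply: uniq_leq_size.
  rewrite map_inj_uniq ?enum_uniq // => w w' E; apply: val_inj; apply: idx_inj => //.
  by rewrite !size_tuple.
move=> _ /mapP[w wS ->]; move: wS; rewrite mem_enum inE => /asboolP[y Uy wy].
have := le_diam Uy Uy0 => /le_trans/(_ dU); rewrite lee_fin.
rewrite -[l%:R ^- n]mul1r ler_pdivlMr // -(gtr0_norm ln0) -normrM mulrBl.
move: wy wy0; rewrite !in_cylinder // -/k => /andP[a1 a2] /andP[b1 b2].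
rewrite ler_norml => /andP[c1 c2].
have h1 : (idx w)%:R < k.+2%:R :> R by rewrite -natr1; lra.
have h2 : k%:R < (idx w).+2%:R :> R by rewrite -[(idx w).+2%:R]natr1; lra.
rewrite !ltr_nat in h1 h2; rewrite !inE.
have : (idx w == k.-1) || (idx w == k) || (idx w == k.+1) by lia.
by rewrite orbA.
Qed.

Definition digits (x : nat -> 'I_l) n : n.-tuple 'I_l := [tuple x i | i < n].

Lemma digitsE x n : digits x n = mkseq x n :> seq 'I_l.
Proof.
apply: (@eq_from_nth _ (x 0%N)); first by rewrite size_tuple size_mkseq.
move=> i; rewrite size_tuple => ni; rewrite nth_mkseq //.
by rewrite -[RHS](tnth_mktuple x (Ordinal ni)) (tnth_nth (x 0%N)).
Qed.

(** The point is the supremum of the left endpoints. Intervals are open on the right, so infinitely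
    many digits other than [l - 1] are required to stay strictly below the right endpoints. *)
Lemma expansion_exists (x : nat -> 'I_l) : (0 < l)%N ->
  (forall n, exists2 m, (n <= m)%N & ((x m).+1 < l)%N) ->
  exists y, forall n, cylinder R (digits x n) y.
Proof.
move=> l0 nt; have lR : 0 < l%:R :> R by rewrite ltr0n.
have ln0 n : 0 < l%:R ^+ n :> R by rewrite exprn_gt0.
pose L n : R := (idx (mkseq x n))%:R / l%:R ^+ n.
pose U n : R := (idx (mkseq x n)).+1%:R / l%:R ^+ n.
have LS n : L n.+1 = L n + (x n)%:R / l%:R ^+ n.+1.
  rewrite /L mkseqS idx_rcons natrD natrM exprS; field.
  by rewrite !gt_eqF.
have US n : U n.+1 = U n - (l%:R - (x n).+1%:R) / l%:R ^+ n.+1.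
  rewrite /U mkseqS idx_rcons -!natr1 natrD natrM exprS; field.
  by rewrite !gt_eqF.
have LU n : L n <= U n by rewrite ler_pM2r ?invr_gt0 // ler_nat.
have Lmono : {homo L : m n / (m <= n)%N >-> m <= n}.
  apply: homo_leq => [//|? ? ?|n]; first exact: le_trans.
  by rewrite LS lerDl divr_ge0 // ltW.
have Umono : {homo U : m n / (m <= n)%N >-> n <= m}.
  apply: homo_leq => [//|? ? ? h1 h2|n]; first exact: le_trans h2 h1.
  by rewrite US gerBl divr_ge0 ?(ltW (ln0 _)) // subr_ge0 ler_nat.
have LUmn m n : L m <= U n.
  apply: le_trans (Lmono _ _ (leq_maxl m n)) _.
  exact: le_trans (LU _) (Umono _ _ (leq_maxr m n)).
have ubL n : ubound (range L) (U n) by move=> _ [m _ <-].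
exists (sup (range L)) => n; apply/in_cylinder => //.
rewrite digitsE -ler_pdivrMr // -ltr_pdivlMr // -/(L n) -/(U n); apply/andP; split.
  by apply: ub_le_sup; [exists (U 0%N); exact: ubL|exists n].
(* The right endpoint drops strictly at a digit smaller than [l - 1]. *)
have [m nm xm] := nt n.
apply: le_lt_trans (_ : U m.+1 < _).
  by apply: ge_sup; [exists (L 0%N), 0%N|exact: ubL].
apply: lt_le_trans (Umono _ _ nm).
by rewrite US gtrBl divr_gt0 // subr_gt0 ltr_nat.
Qed.

End adic_intervals.

(** * Outer measure on sequences *)

Section charges.
Context {R : realType} {l : nat} (mu : seq 'I_l -> R).
Hypothesis mu0 : forall w, 0 <= mu w.
Hypothesis mu_rcons : forall w, \sum_j mu (rcons w j) = mu w.
Implicit Types (c : seq 'I_l -> \bar R) (B : set (nat -> 'I_l)) (e : \bar R).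

Definition charge c := (forall v, 0 <= c v)%E /\
  forall v, (\sum_j c (rcons v j) <= c v)%E.

(* [B] has outer measure at most [e] for the measure on sequences giving mass
   [mu w] to the cylinder of [w]: a fractional cover [c] reaches the full mass
   of some prefix of every point of [B]. *)
Definition covered B e := exists c, [/\ charge c, (c [::] <= e)%E &
  forall x, B x -> exists n, ((mu (mkseq x n))%:E <= c (mkseq x n))%E].

(** While [c] is below [mu] at a word, it is below [mu] at some child, by consistency of [mu].
    Following such children forever gives a sequence none of whose prefixes is covered. *)
Lemma covered_exists_notin B e : covered B e -> (e < (mu [::])%:E)%E ->
  exists x, ~ B x.
Proof.
move=> [c [[c0 cr] ce cB]] emu.
have ex v : (c v < (mu v)%:E)%E ->
    exists j, (c (rcons v j) < (mu (rcons v j))%:E)%E.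
  move=> cv; apply/not_existsP => H.
  have : ((mu v)%:E <= c v)%E.
    rewrite -mu_rcons -sumEFin; apply: le_trans (cr v).
    by apply: lee_sum => j _; rewrite leNgt; exact/negP.
  by rewrite leNgt cv.
have c_nil : (c [::] < (mu [::])%:E)%E by exact: le_lt_trans emu.
have [j0 _] := ex _ c_nil.
have /choice[next nextP] : forall v, exists j,
    (c v < (mu v)%:E)%E -> (c (rcons v j) < (mu (rcons v j))%:E)%E.
  move=> v; have [/ex[j cj]|cv] := boolP (c v < (mu v)%:E)%E; first by exists j.
  by exists j0.
pose path n := iter n (fun v => rcons v (next v)) [::].
have pathE n : mkseq (fun k => next (path k)) n = path n.
  by elim: n => // n IH; rewrite mkseqS IH.
exists (fun k => next (path k)) => /cB[n]; rewrite pathE leNgt => /negP; apply.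
by elim: n => // n /nextP.
Qed.

Lemma covered_sub B B' e e' : B `<=` B' -> (e' <= e)%E -> covered B' e' -> covered B e.
Proof.
move=> BB' e'e [c [cc ce cB]]; exists c; split => //; first exact: le_trans e'e.
by move=> x /BB'; exact: cB.
Qed.

(** Charges add up, even countably many of them; this is why they take values in the extended
    reals. *)
Lemma covered_bigcup (B : nat -> set (nat -> 'I_l)) (e : nat -> \bar R) :
  (forall k, covered (B k) (e k)) -> covered (\bigcup_k B k) (\sum_(k <oo) e k)%E.
Proof.
move=> /choice[c cP]; exists (fun v => \sum_(k <oo) c k v)%E.
have c0 k v : (0 <= c k v)%E by have [[]] := cP k.
split.
- split=> v; first by apply: nneseries_ge0 => k _ _.
  rewrite -nneseries_sum //; apply: lee_nneseries => k _.
    by move=> _; exact: sume_ge0.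
  by have [[_]] := cP k.
- by apply: lee_nneseries => k // _; have [] := cP k.
- move=> x [k _ Bx]; have [_ _ /(_ x Bx)[n xn]] := cP k; exists n.
  apply: le_trans xn _; apply: le_trans (nneseries_lim_ge k.+1 _) => //.
  by rewrite big_nat_recr //= leeDr // sume_ge0.
Qed.

Lemma covered_setU B1 B2 e1 e2 : covered B1 e1 -> covered B2 e2 ->
  covered (B1 `|` B2) (e1 + e2)%E.
Proof.
move=> [c1 [[c10 c1r] c1e c1B]] [c2 [[c20 c2r] c2e c2B]].
exists (fun v => c1 v + c2 v)%E; split.
- split=> v; first exact: adde_ge0.
  by rewrite big_split /= leeD.
- exact: leeD.
- move=> x [/c1B|/c2B] [n xn]; exists n; apply: le_trans xn _.
    by rewrite leeDl.
  by rewrite leeDr.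
Qed.

Lemma covered_bigU (I : choiceType) (s : seq I) (B : I -> set (nat -> 'I_l)) (e : I -> \bar R) :
  (forall i, i \in s -> covered (B i) (e i)) ->
  covered [set x | exists2 i, i \in s & B i x] (\sum_(i <- s) e i)%E.
Proof.
elim: s => [|i s IH] H.
  exists (fun=> 0%E); split; first by split => // v; rewrite big1.
    by rewrite big_nil.
  by move=> x [].
rewrite big_cons; have cU := covered_setU (H i (mem_head _ _))
  (IH (fun j js => H j (@mem_behead _ (i :: s) _ js))).
apply: (covered_sub _ (lexx _) cU) => x [j]; rewrite inE => /orP[/eqP->|js] Bx.
  by left.
by right; exists j.
Qed.

(** The charge is the restriction of [mu] to the cylinder of [w]: [mu w] on prefixes of [w], [mu] on
    extensions, 0 elsewhere. *)
Lemma covered_word (w : seq 'I_l) :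
  covered [set x | mkseq x (size w) = w] (mu w)%:E.
Proof.
pose c v := if (size v <= size w)%N then (if take (size v) w == v then mu w else 0)
  else if take (size w) v == w then mu v else 0.
exists (fun v => (c v)%:E); split.
- split=> v; first by rewrite lee_fin /c; do 2 case: ifP.
  rewrite sumEFin lee_fin /c.
  have [vw|wv] := ltnP (size v) (size w).
    rewrite (ltnW vw); under eq_bigr do rewrite size_rcons vw.
    have a := tnth (in_tuple w) (Ordinal vw).
    under eq_bigr do rewrite (take_nth a vw) eqseq_rcons.
    case: eqP => E /=; last by rewrite big1.
    by rewrite -big_mkcond (big_pred1 (nth a w (size v))) // => j; rewrite eq_sym.
  under eq_bigr do rewrite size_rcons leqNgt ltnS wv /= -cats1 takel_cat //.
  have -> : (if (size v <= size w)%N then if take (size v) w == v then mu w else 0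
     else if take (size w) v == w then mu v else 0) = if take (size w) v == w then mu v else 0.
    case: ifP => // vw; have E : size v = size w by apply/eqP; rewrite eqn_leq vw.
    by rewrite E take_size -E take_size eq_sym; case: eqP => [->|].
  by case: ifP => _; [under eq_bigr do rewrite cats1; rewrite mu_rcons|rewrite big1].
- by rewrite /c take0.
- by move=> x xw; exists (size w); rewrite xw /c leqnn take_size eqxx.
Qed.

Lemma covered_level n (W : {set n.-tuple 'I_l}) :
  covered [set x | digits x n \in W] (\sum_(w in W) mu w)%:E.
Proof.
rewrite -sumEFin -big_enum /=.
have cW := @covered_bigU _ (enum W)
  (fun w : n.-tuple 'I_l => [set x | mkseq x (size w) = w]) _
  (fun w _ => covered_word w).
apply: (covered_sub _ (lexx _) cW) => x xW; exists (digits x n); first by rewrite mem_enum.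
by rewrite /mkset size_tuple digitsE.
Qed.

End charges.

(** * Gibbs weights and the structure function *)

Section words.
Context {R : realType} {l : nat} (p : 'I_l -> R) (P : 'M[R]_l).

Lemma word_weight_rcons i s j :
  word_weight p P (rcons (i :: s) j) = word_weight p P (i :: s) * P (last i s) j.
Proof.
rewrite /word_weight /= -mulrA; congr (_ * _).
elim: s i => [|k s IH] i /=; first by rewrite big_cons !big_nil mulr1 mul1r.
by rewrite big_cons IH [in RHS]big_cons mulrA.
Qed.

Lemma sum_tuple_rcons n (F : seq 'I_l -> R) :
  \sum_(w : n.+1.-tuple 'I_l) F w = \sum_(w : n.-tuple 'I_l) \sum_j F (rcons w j).
Proof.
rewrite pair_big /=.
pose h (a : n.-tuple 'I_l * 'I_l) := [tuple of rcons a.1 a.2].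
rewrite (reindex h) //; apply: onW_bij; apply: inj_card_bij.
  move=> [w i] [w' j] /(congr1 val) /= /rcons_inj[ww' ->].
  by congr (_, _); exact: val_inj.
by rewrite card_prod !card_tuple card_ord expnSr.
Qed.

Hypotheses (p0 : forall i, 0 <= p i) (P0 : forall i j, 0 <= P i j).

Lemma word_weight_ge0 w : 0 <= word_weight p P w.
Proof.
by case: w => [|i s] //=; rewrite mulr_ge0 // prodr_ge0.
Qed.

Variables (q rho : R) (v : 'I_l -> R).
Hypothesis Pv : perron_pair P q rho v.

(* The weight of a nonempty word [w] is [m(I_w)^q |I_w|^tau(q)] times the entry
   of the eigenvector at its last letter, which makes the weights consistent. *)
Definition gibbs (w : seq 'I_l) : R :=
  if w is i :: s then pw (word_weight p P w) q / rho ^+ size w * v (last i s)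
  else \sum_j pw (p j) q / rho * v j.

Lemma gibbs_rcons w : \sum_j gibbs (rcons w j) = gibbs w.
Proof.
have [rho0 _ Mv] := Pv; case: w => [|i s].
  by apply: eq_bigr => j _; rewrite /gibbs /= big_nil mulr1.
rewrite (eq_bigr (fun j => pw (word_weight p P (i :: s)) q / rho ^+ (size s).+2
   * (pmx P q (last i s) j * v j))) => [|j _]; last first.
  transitivity (pw (word_weight p P (rcons (i :: s) j)) q /
    rho ^+ size (rcons (i :: s) j) * v (last i (rcons s j))) => //.
  rewrite last_rcons word_weight_rcons pwM ?word_weight_ge0 // size_rcons.
  by rewrite /pmx /=; ring.
rewrite -mulr_sumr -/(op (pmx P q) v (last i s)) Mv exprS /gibbs.
by field; rewrite expf_neq0 gt_eqF.
Qed.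

Lemma gibbs_ge0 w : 0 <= gibbs w.
Proof.
have [rho0 v0 _] := Pv; case: w => [|i s] /=.
  by apply: sumr_ge0 => j _; rewrite mulr_ge0 ?divr_ge0 ?pw_ge0 // ltW.
by rewrite mulr_ge0 ?divr_ge0 ?pw_ge0 ?exprn_ge0 // ltW.
Qed.

Lemma sum_gibbs n : \sum_(w : n.-tuple 'I_l) gibbs w = gibbs [::].
Proof.
elim: n => [|n IH].
  by rewrite (big_pred1 [tuple]) // => w; rewrite [w]tuple0 /= eqxx.
by rewrite sum_tuple_rcons -IH; apply: eq_bigr => w _; exact: gibbs_rcons.
Qed.

Lemma gibbs_nil_gt0 : \sum_i p i = 1 -> 0 < gibbs [::].
Proof.
move=> p1; have [rho0 v0 _] := Pv.
have [i pi] : exists i, 0 < p i.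
  apply/not_existsP => H; suff : \sum_i p i = 0 by move/eqP; rewrite p1 oner_eq0.
  by apply: big1 => i _; apply/eqP; rewrite eq_le p0 andbT leNgt; apply/negP/H.
rewrite /gibbs (bigD1 i) //= ltr_pwDl //; last first.
  by apply: sumr_ge0 => j _; rewrite mulr_ge0 ?divr_ge0 ?pw_ge0 // ltW.
by rewrite mulr_gt0 ?divr_gt0 ?pw_gt0.
Qed.

End words.

(** * The structure function as logarithm of the Perron root *)

Section structure_function.
Context {R : realType} {l : nat} (p : 'I_l -> R) (P : 'M[R]_l).
Hypotheses (l1 : (1 < l)%N) (hp : prob_vector p) (hP : stochastic P).

Let p0 i : 0 <= p i. Proof. by case: hp. Qed.
Let P0 i j : 0 <= P i j. Proof. by case: (hP i). Qed.
Let l0 : (0 < l)%N. Proof. exact: ltnW. Qed.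

Definition word_sum n q : R :=
  \sum_(w : n.-tuple 'I_l) pw (word_weight p P w) q.

(** The total Gibbs mass is the same at all orders, and the eigenvector lies between two positive
    constants; dividing it out leaves [rho ^ n] up to constants. *)
Lemma word_sum_bounds q rho v : perron_pair P q rho v ->
  exists a b : R, [/\ 0 < a, 0 < b & forall n, (0 < n)%N ->
    a * rho ^+ n <= word_sum n q <= b * rho ^+ n].
Proof.
move=> Pv; have [rho0 v0 _] := Pv.
have [a a0 Ha] := fin_pos_lb v0; have [b b0 Hb] := fin_ub v.
have g0 := gibbs_nil_gt0 p0 Pv hp.2.
exists (gibbs p P q rho v [::] / b), (gibbs p P q rho v [::] / a).
split; [exact: divr_gt0|exact: divr_gt0|move=> n n0].
have rn0 : 0 < rho ^+ n by rewrite exprn_gt0.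
rewrite -(sum_gibbs p0 P0 Pv n) !mulr_suml /word_sum.
apply/andP; split; apply: ler_sum => -[[|i s] /= sw] _;
  move: (sw); rewrite /= => /eqP sn; rewrite ?sn; try by rewrite -sn in n0.
  rewrite mulrAC ler_pdivrMr // mulrAC divfK ?gt_eqF // ler_wpM2l ?pw_ge0 //.
rewrite mulrAC ler_pdivlMr // [leRHS]mulrAC divfK ?gt_eqF // ler_wpM2l ?pw_ge0 //.
Qed.

Variable m : probability (measurableTypeR R) R.
Hypothesis hm : markov_measure p P m.

Lemma partition_sumE n q : (0 < n)%N -> partition_sum l m n q = word_sum n q.
Proof.
move=> n0; rewrite /partition_sum (sum_adic n _ l0).
apply: eq_bigr => w _; rewrite hm.2 //= eqe /pw.
case: eqP => // /eqP w0; rewrite /powR (negbTE w0).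
by [].
Qed.

(** By [word_sum_bounds], the logarithm of the partition sum is [n * ln rho] up to a bounded error,
    so the upper limit is a genuine limit. *)
Lemma tauE q rho v : perron_pair P q rho v -> tau l m q = (ln rho / ln l%:R)%:E.
Proof.
move=> Pv; have [rho0 v0 _] := Pv.
have [a [b [a0 b0 H]]] := word_sum_bounds Pv.
have lam0 : 0 < ln l%:R :> R by rewrite ln_gt0 // ltr1n.
pose C := `|ln a| + `|ln b|.
suff C1 : (n%:R * ln l%:R)^-1 * ln (partition_sum l m n q) @[n --> \oo] --> ln rho / ln l%:R.
  have C2 : ((n%:R * ln l%:R)^-1 * ln (partition_sum l m n q))%:E @[n --> \oo] -->
      (ln rho / ln l%:R)%:E.
    by apply/fine_cvgP; split => //; exact: nearW.
  rewrite /tau is_cvg_limn_esupE; first exact: (cvg_lim _ C2).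
  by apply: (cvgP _ C2).
apply/cvgrPdist_le => e e0; near=> n.
have n0 : (0 < n)%N by near: n; exact: nbhs_infty_gt.
have nR : 0 < n%:R :> R by rewrite ltr0n.
rewrite partition_sumE //.
have /andP[Ha Hb] := H n n0; set Z := word_sum n q in Ha Hb *.
have rn0 : 0 < rho ^+ n by rewrite exprn_gt0.
have Z0 : 0 < Z by apply: lt_le_trans Ha; rewrite mulr_gt0.
have la : ln a + n%:R * ln rho <= ln Z.
  by rewrite mulr_natl -lnXn // -lnM ?posrE // ler_ln ?posrE // mulr_gt0.
have lb : ln Z <= ln b + n%:R * ln rho.
  by rewrite mulr_natl -lnXn // -lnM ?posrE // ler_ln ?posrE // mulr_gt0.
have -> : ln rho / ln l%:R - (n%:R * ln l%:R)^-1 * ln Z =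
   (n%:R * ln rho - ln Z) / (n%:R * ln l%:R) by field; rewrite !gt_eqF.
rewrite normrM normfV (gtr0_norm (mulr_gt0 nR lam0)) ler_pdivrMr ?mulr_gt0 //.
apply: le_trans (_ : C <= _).
  rewrite ler_norml /C; have := ler_norm (ln b); have := ler_norm (- ln a).
  have := normr_ge0 (ln a); have := normr_ge0 (ln b).
  by rewrite normrN => ? ? ? ?; apply/andP; split; lra.
rewrite mulrCA -ler_pdivrMr ?mulr_gt0 //.
by near: n; apply: nbhs_infty_ger; rewrite num_real.
Unshelve. all: by end_near.
Qed.

End structure_function.

(** * Level sets in terms of cylinder weights *)

Section level_sets.
Context {R : realType} {l : nat} (p : 'I_l -> R) (P : 'M[R]_l).
Hypotheses (l1 : (1 < l)%N) (hp : prob_vector p) (hP : stochastic P).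
Variable m : probability (measurableTypeR R) R.
Hypothesis hm : markov_measure p P m.

Let l0 : (0 < l)%N. Proof. exact: ltnW. Qed.
Let wt0 w : 0 <= word_weight p P w.
Proof. by apply: word_weight_ge0 => [i|i j]; [case: hp|case: (hP i)]. Qed.

(* [m(I_w) = |I_w| ^ (a +- e)], in logarithmic form *)
Definition typical (a e : R) (w : seq 'I_l) : bool :=
  (0 < word_weight p P w) &&
  (`|ln (word_weight p P w) + a * ((size w)%:R * ln l%:R)| <= e * ((size w)%:R * ln l%:R)).

Lemma ln_l_gt0 : 0 < ln l%:R :> R.
Proof. by rewrite ln_gt0 // ltr1n. Qed.

Lemma ler_dist_quotient (K L a e : R) : 0 < K ->
  (`|a - - L / K| <= e) = (`|L + a * K| <= e * K).
Proof.
move=> K0; rewrite -(ler_pM2r K0) -[X in _ * X <= _](gtr0_norm K0) -normrM.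
by congr (`|_| <= _); field; rewrite gt_eqF.
Qed.

(** A null cylinder gives [-oo] divided by a negative number, hence [+oo]; such values are what the
    finiteness part of the convergence excludes. *)
Lemma local_dimension n (w : n.-tuple 'I_l) y : (0 < n)%N -> cylinder R w y ->
  (lne (m (adic_at l n y)) / lne (lebesgue_measure (adic_at l n y)))%E =
  if word_weight p P w == 0 then +oo%E
  else (- ln (word_weight p P w) / (n%:R * ln l%:R))%:E.
Proof.
move=> n0 wy; rewrite (adic_atE l0 wy) hm.2 // lebesgue_cylinder //.
have nl : 0 < n%:R * ln l%:R :> R by rewrite mulr_gt0 ?ln_l_gt0 // ltr0n.
have ln0 : 0 < l%:R ^+ n :> R by rewrite exprn_gt0 // ltr0n.
rewrite [X in (_ / X)%E]lne_EFin ?invr_gt0 // lnV ?posrE // lnXn ?ltr0n //.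
rewrite -[ln _ *+ n]mulr_natl inver oppr_eq0 (gt_eqF nl).
case: eqP => [->|/eqP w0].
  by rewrite le0_lneNy // lt0_mulNye // lte_fin invr_lt0 oppr_lt0.
rewrite lne_EFin ?lt_neqAle ?wt0 1?eq_sym ?w0 // -EFinM.
by rewrite invrN mulrN mulNr.
Qed.

Lemma level_set_typical (a e : R) y : 0 < e -> level_set l m a y ->
  exists N, forall n (w : n.-tuple 'I_l), (N <= n)%N -> cylinder R w y -> typical a e w.
Proof.
move=> e0 [y01 /fine_cvgP[fin_lim /cvgrPdist_le/(_ e e0) H]].
have [N _ HN] := filterI fin_lim H.
exists N.+1 => n w Nn wy.
have n0 : (0 < n)%N by exact: leq_ltn_trans Nn.
have [] := HN n (ltnW Nn); rewrite /= (local_dimension n0 wy).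
case: eqP => [//|/eqP w0] _.
have wp : 0 < word_weight p P w by rewrite lt_neqAle eq_sym w0 wt0.
have nl : 0 < n%:R * ln l%:R :> R by rewrite mulr_gt0 ?ln_l_gt0 // ltr0n.
by rewrite /typical wp size_tuple ler_dist_quotient.
Qed.

Lemma typical_level_set (a : R) y : 0 <= y < 1 ->
  (forall e, 0 < e -> exists N, forall n (w : n.-tuple 'I_l), (N <= n)%N ->
    cylinder R w y -> typical a e w) ->
  level_set l m a y.
Proof.
move=> y01 H; split => //; apply/fine_cvgP; split.
  have [N HN] := H 1 ltr01; exists N.+1 => // n /= Nn.
  have [w wy] := cylinder_exists n l0 y01.
  have /andP[wp _] := HN n w (ltnW Nn) wy.
  by rewrite (local_dimension (leq_ltn_trans _ Nn) wy) // (gt_eqF wp).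
apply/cvgrPdist_le => e e0; have [N HN] := H e e0.
exists N.+1 => // n /= Nn.
have n0 : (0 < n)%N by exact: leq_ltn_trans Nn.
have [w wy] := cylinder_exists n l0 y01.
have /andP[wp] := HN n w (ltnW Nn) wy.
rewrite (local_dimension n0 wy) (gt_eqF wp) size_tuple /=.
have nl : 0 < n%:R * ln l%:R :> R by rewrite mulr_gt0 ?ln_l_gt0 // ltr0n.
by rewrite ler_dist_quotient.
Qed.

End level_sets.

(** * Upper bound *)

Section geometric_series.
Context {R : realType}.

Lemma nneseries_geometric (C t : R) : 0 <= t < 1 ->
  (\sum_(k <oo) (C * t ^+ k)%:E = (C / (1 - t))%:E)%E.
Proof.
move=> /andP[t0 t1]; apply: cvg_lim => //.
have := @cvg_geometric_series R C t; rewrite ger0_norm // => /(_ t1) H.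
rewrite (_ : (fun n => _) = EFin \o series (geometric C t)).
  by apply/fine_cvgP; split => //; exact: nearW.
by apply/funext => n; rewrite /= sumEFin.
Qed.

Lemma geometric_small (C t e : R) : 0 <= t < 1 -> 0 < e ->
  exists N, forall n, (N <= n)%N -> C * t ^+ n <= e.
Proof.
move=> /andP[t0 t1] e0.
have := @cvg_geometric R C t; rewrite ger0_norm // => /(_ t1)/cvgrPdist_le/(_ e e0)[N _ H].
exists N => n Nn; have := H n Nn; rewrite /geometric /= sub0r normrN.
by apply: le_trans; exact: ler_norm.
Qed.

End geometric_series.

(** Lets a finite family serve as an infinite cover: the sequence is padded with [x0], which
    contributes nothing. *)
Lemma nneseries_nth_le (R : realType) (T : eqType) (x0 : T) (s : seq T)
    (f : T -> \bar R) (K : R) : (forall x, 0 <= f x)%E -> f x0 = 0%E ->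
  {in s, forall x, f x <= K%:E}%E ->
  (\sum_(j <oo) f (nth x0 s j) <= ((size s)%:R * K)%:E)%E.
Proof.
move=> f0 fx0; elim: s => [|x s IH] sK.
  by rewrite eseries0 ?mul0r // => j _ _; rewrite nth_nil.
rewrite nneseries_recl // -(nneseries_addn 1) //.
have -> : ((size (x :: s))%:R * K)%:E = (K%:E + ((size s)%:R * K)%:E)%E.
  by rewrite -EFinD /= -natr1; congr EFin; ring.
rewrite leeD //; first by apply: sK; rewrite mem_head.
under eq_eseriesr do rewrite addn1 /=.
by apply: IH => y ys; apply: sK; rewrite inE ys orbT.
Qed.

(** * Covers and Hausdorff premeasures *)

Section hausdorff_covers.
Context {R : realType}.
Implicit Types (A U : set R).

Lemma diam_pow_ge0 (s : R) U : (0 <= diam_pow s U)%E.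
Proof. by rewrite /diam_pow; case: ifP => // _; exact: poweR_ge0. Qed.

Lemma diam_set0 : diam (set0 : set R) = -oo%E.
Proof.
rewrite /diam (_ : [set _ | _ in _] = set0) ?ereal_sup0 //.
by apply/seteqP; split => // x [[a b] []].
Qed.

Lemma diam_ge0 U : U !=set0 -> (0 <= diam U)%E.
Proof. by move=> [x Ux]; have := le_diam Ux Ux; rewrite subrr normr0. Qed.

Lemma hausdorff_premeasure_ge0 (s d : R) A : (0 <= hausdorff_premeasure s d A)%E.
Proof.
apply: le_ereal_inf_tmp => _ [U _ <-]; apply: nneseries_ge0 => n _ _.
exact: diam_pow_ge0.
Qed.

(** A bijection between [nat] and pairs turns the doubly indexed cover into a sequence, and
    nonnegative terms may be summed in any order. *)
Lemma hausdorff_premeasure_le2 (s d : R) A (U : nat -> nat -> set R) :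
  A `<=` \bigcup_n \bigcup_j U n j -> (forall n j, diam (U n j) <= d%:E)%E ->
  (hausdorff_premeasure s d A <= \sum_(n <oo) \sum_(j <oo) diam_pow s (U n j))%E.
Proof.
move=> AU Ud; have /card_esym/ppcard_eqP[f] := card_nat2.
rewrite (_ : (\sum_(n <oo) _)%E = \sum_(i <oo) diam_pow s (U (f i).1 (f i).2))%E.
  apply: ereal_inf_lbound; exists (fun i => U (f i).1 (f i).2) => //; split=> // x.
  by move=> /AU[n _ [j _ Ux]]; exists (f^-1%FUN (n, j)) => //=; rewrite invK ?inE.
transitivity (\esum_(x in [set: nat] `*`` fun=> [set: nat]) diam_pow s (U x.1 x.2))%E.
  rewrite -(@esum_esum _ _ _ setT (fun=> setT) (fun n j => diam_pow s (U n j))) //; last first.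
    by move=> *; exact: diam_pow_ge0.
  rewrite nneseries_esumT; last by move=> n; apply: nneseries_ge0 => *; exact: diam_pow_ge0.
  by apply: eq_esum => n _; rewrite nneseries_esumT // => j; exact: diam_pow_ge0.
rewrite (_ : [set: nat] `*`` _ = [set: nat * nat]); last first.
  by apply/seteqP; split => // -[].
rewrite nneseries_esumT; last by move=> i; exact: diam_pow_ge0.
by rewrite (@reindex_esum _ _ _ setT setT f); last exact: 'bij_f.
Qed.

End hausdorff_covers.

Lemma diam_pow_cylinder (R : realType) (l n : nat) (s : R) (w : n.-tuple 'I_l) :
  (0 < l)%N -> 0 <= s ->
  (diam_pow s (cylinder R w) <= (expR (- (s * (n%:R * ln l%:R))))%:E)%E.
Proof.
move=> l0 s0; have [y wy] := cylinder_neq0 w l0 (R := R).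
have ne : cylinder R w !=set0 by exists y.
rewrite /diam_pow; case: eqP => [E|_]; first by move: wy; rewrite E.
have ln0 : 0 < l%:R ^+ n :> R by rewrite exprn_gt0 // ltr0n.
apply: le_trans (_ : (poweR (l%:R ^- n)%:E s <= _)%E).
  apply: gt0_ler_poweR => //; rewrite ?in_itv /= ?leey ?andbT.
  - exact: diam_ge0.
  - by rewrite lee_fin invr_ge0 ltW.
  - exact: diam_cylinder.
rewrite poweR_EFin lee_fin /powR invr_eq0 (gt_eqF ln0).
by rewrite lnV ?posrE // lnXn ?ltr0n // -[ln _ *+ n]mulr_natl mulrN.
Qed.

Section upper_bound.
Context {R : realType} {l : nat} (p : 'I_l -> R) (P : 'M[R]_l).
Hypotheses (l1 : (1 < l)%N) (hp : prob_vector p) (hP : stochastic P).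
Variable m : probability (measurableTypeR R) R.
Hypothesis hm : markov_measure p P m.

Let l0 : (0 < l)%N. Proof. exact: ltnW. Qed.
Let lam := ln l%:R : R.
Let lam0 : 0 < lam. Proof. exact: ln_l_gt0. Qed.

Lemma typical_pw (a e q : R) (w : seq 'I_l) : typical p P a e w ->
  `|q * ln (word_weight p P w) + a * q * ((size w)%:R * lam)|
    <= `|q| * e * ((size w)%:R * lam).
Proof.
move=> /andP[_ h]; rewrite (_ : _ + _ =
  q * (ln (word_weight p P w) + a * ((size w)%:R * lam))); last by ring.
by rewrite normrM -mulrA ler_wpM2l.
Qed.

(** Each typical word contributes at least [exp (- E)] to the partition sum, which is at most a
    constant times [rho ^ n]. *)
Lemma card_typical (a e q rho : R) v : perron_pair P q rho v ->
  exists2 C, 0 < C & forall n, (0 < n)%N ->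
    #|[set w : n.-tuple 'I_l | typical p P a e w]%SET|%:R <=
    C * expR ((a * q + ln rho / lam + `|q| * e) * (n%:R * lam)).
Proof.
move=> Pv; have [rho0 _ _] := Pv.
have [a' [b [_ b0 H]]] := word_sum_bounds hp hP Pv.
exists b => // n n0; have /andP[_ Hb] := H n n0.
set S := [set _ | _]%SET; set E := (a * q + `|q| * e) * (n%:R * lam).
apply: le_trans (_ : expR E * word_sum p P n q <= _); last first.
  apply: le_trans (ler_wpM2l (expR_ge0 _) Hb) _.
  rewrite mulrCA ler_pM2l // -[rho in leLHS]lnK ?posrE // -expRM_natl -expRD ler_expR.
  by rewrite le_eqVlt; apply/orP; left; apply/eqP; rewrite /E; field; rewrite gt_eqF.
rewrite -sum1_card natr_sum /word_sum mulr_sumr big_mkcond /=.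
apply: ler_sum => w _; case: ifPn => [|_]; last by rewrite mulr_ge0 ?expR_ge0 ?pw_ge0.
rewrite inE => tw; have := typical_pw q tw.
rewrite size_tuple ler_norml => /andP[h _]; move: tw => /andP[wp _].
by rewrite pwE // -expRD -[leLHS]expR0 ler_expR /E; lra.
Qed.

(** Typical cylinders of all orders from [N] on cover the level set. At order [n] their number times
    [|I| ^ s] is at most [C * t ^ n] with [t < 1], so the total is a small geometric tail. *)
Lemma hausdorff_measure_level_set_eq0 (a q rho s : R) v : perron_pair P q rho v ->
  0 <= s -> a * q + ln rho / lam < s ->
  hausdorff_measure s (level_set l m a) = 0%E.
Proof.
move=> Pv s0 hs; set D := a * q + ln rho / lam in hs.
(* This tolerance spends at most half of the gap [s - D] on the error term [|q| * e]. *)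
pose e := (s - D) / (2 * (`|q| + 1)).
have q1 : 0 < `|q| + 1 by rewrite ltr_wpDl.
have e0 : 0 < e by rewrite divr_gt0 ?subr_gt0 // mulr_gt0.
have qe : `|q| * e <= (s - D) / 2.
  have -> : `|q| * e = (s - D) / 2 * (`|q| / (`|q| + 1)).
    by rewrite /e; field; rewrite gt_eqF.
  rewrite ler_piMr //; first by rewrite divr_ge0 // subr_ge0 ltW.
  by rewrite ler_pdivrMr // mul1r lerDl.
have [C C0 HC] := card_typical a e Pv.
pose t := expR (- ((s - D) / 2 * lam)).
have t01 : 0 <= t < 1.
  by rewrite expR_ge0 /= expR_lt1 oppr_lt0 mulr_gt0 // divr_gt0 // subr_gt0.
pose W n := enum [set w : n.-tuple 'I_l | typical p P a e w]%SET.
(* Indices past the end give [set0], with [diam_pow] 0 and diameter [-oo], so they cost nothing and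
   respect every diameter bound. *)
pose U N n j := nth set0 [seq cylinder R w | w <- W (N + n)%N] j.
have Usum N n : (0 < N)%N -> (\sum_(j <oo) diam_pow s (U N n j) <= (C * t ^+ N * t ^+ n)%:E)%E.
  move=> N0; have Nn0 : (0 < N + n)%N by rewrite addn_gt0 N0.
  apply: le_trans.
    apply: (@nneseries_nth_le _ _ _ _ _ (expR (- (s * ((N + n)%:R * lam))))).
    - exact: diam_pow_ge0.
    - by rewrite /diam_pow eqxx.
    - by move=> _ /mapP[w _ ->]; exact: diam_pow_cylinder.
  rewrite lee_fin size_map -cardE.
  apply: le_trans (ler_wpM2r (expR_ge0 _) (HC _ Nn0)) _.
  rewrite -!mulrA ler_pM2l // -expRD -exprD /t -expRM_natl ler_expR.
  rewrite -/D; have : 0 <= (N + n)%:R * lam by rewrite mulr_ge0 // ltW.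
  by nra.
apply/eqP; rewrite eq_le; apply/andP; split; last first.
  apply: le_trans (hausdorff_premeasure_ge0 s 1 (level_set l m a)) _.
  by apply: ereal_sup_ubound; exists 1 => //; exact: ltr01.
apply: ge_ereal_sup => _ [d /= d0 <-].
apply/lee_addgt0Pr => eps eps0; rewrite add0e.
have [N1 HN1] := geometric_small (C / (1 - t)) t01 eps0.
have l01 : 0 <= (l%:R^-1 : R) < 1 by rewrite invr_ge0 ler0n invf_lt1 ?ltr0n // ltr1n.
have [N2 HN2] := geometric_small 1 l01 d0.
(* [N1] makes the series at most [eps], [N2] the diameters at most [d], and the successor keeps all
   orders positive. *)
pose N := (N1 + N2).+1.
have NE : (0 < N)%N by [].
apply: le_trans (_ : (\sum_(n <oo) \sum_(j <oo) diam_pow s (U N n j) <= _)%E).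
  apply: hausdorff_premeasure_le2.
    move=> y Ey; have [N3 HN3] := level_set_typical l1 hp hP hm e0 Ey.
    have [w wy] := cylinder_exists (N + N3) l0 Ey.1.
    exists N3 => //; exists (index w (W (N + N3)%N)) => //.
    have wW : w \in W (N + N3)%N by rewrite mem_enum inE; apply: HN3 wy; rewrite leq_addl.
    by rewrite /U (nth_map w) ?index_mem // nth_index.
  move=> n j; rewrite /U.
  have [jn|nj] := ltnP j (size [seq cylinder R w | w <- W (N + n)%N]); last first.
    by rewrite nth_default // diam_set0 leNye.
  have /mapP[w _ ->] := mem_nth set0 jn.
  apply: le_trans (diam_cylinder w) _; rewrite lee_fin.
  have := HN2 (N + n)%N; rewrite mul1r exprVn; apply.
  by rewrite /N addSn leqW // -addnA addnCA leq_addr.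
apply: le_trans (_ : (\sum_(n <oo) (C * t ^+ N * t ^+ n)%:E <= _)%E).
  apply: lee_nneseries => [n _ _|n _]; last exact: Usum.
  by apply: nneseries_ge0 => j _ _; exact: diam_pow_ge0.
rewrite nneseries_geometric // lee_fin mulrAC; apply: HN1.
by rewrite /N ltnW // ltnS leq_addr.
Qed.

End upper_bound.

(** * Lower bound *)

Section lower_bound.
Context {R : realType} {l : nat} (p : 'I_l -> R) (P : 'M[R]_l).
Hypotheses (l1 : (1 < l)%N) (hp : prob_vector p) (hP : stochastic P).
Variable m : probability (measurableTypeR R) R.
Hypothesis hm : markov_measure p P m.

Let l0 : (0 < l)%N. Proof. exact: ltnW. Qed.
Let lam := ln l%:R : R.
Let lam0 : 0 < lam. Proof. exact: ln_l_gt0. Qed.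
Let p0 i : 0 <= p i. Proof. by case: hp. Qed.
Let P0 i j : 0 <= P i j. Proof. by case: (hP i). Qed.
Let wt0 w : 0 <= word_weight p P w. Proof. exact: word_weight_ge0. Qed.

Section gibbs_estimates.
Variables (q rho : R) (v : 'I_l -> R).
Hypothesis Pv : perron_pair P q rho v.
Local Notation g := (gibbs p P q rho v).

Lemma gibbsE w : w != [::] -> exists i, g w = pw (word_weight p P w) q *
  expR (- (ln rho / lam * ((size w)%:R * lam))) * v i.
Proof.
have [rho0 _ _] := Pv; case: w => // i s _; exists (last i s).
rewrite /gibbs; congr (_ * _ * _).
rewrite expRN -[rho in LHS]lnK ?posrE // -expRM_natl; congr ((expR _)^-1).
by field; rewrite gt_eqF.
Qed.

(** On a typical word [m(I) ^ q] is close to [|I| ^ (a * q)], so the Gibbs weight is [|I|] to the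
    power [a * q + ln rho / lam], up to [|q| * e] in the exponent and the bounds on the
    eigenvector. *)
Lemma gibbs_typical_bounds : exists c C : R, [/\ 0 < c, 0 < C &
  forall a e w, w != [::] -> typical p P a e w ->
    c * expR (- ((a * q + ln rho / lam + `|q| * e) * ((size w)%:R * lam))) <= g w /\
    g w <= C * expR (- ((a * q + ln rho / lam - `|q| * e) * ((size w)%:R * lam)))].
Proof.
have [rho0 v0 _] := Pv.
have [c c0 Hc] := fin_pos_lb v0; have [C C0 HC] := fin_ub v.
exists c, C; split => // a e w wn tw.
have [i ->] := gibbsE wn.
have := typical_pw q tw.
rewrite ler_norml -/lam => /andP[h1 h2]; move: tw => /andP[wp _].
rewrite pwE // -expRD ![_ * v i]mulrC; split.
  by apply: ler_pM; rewrite ?expR_ge0 ?(ltW c0) // ler_expR; lra.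
by apply: ler_pM; rewrite ?expR_ge0 ?(ltW (v0 i)) // ler_expR; lra.
Qed.

Lemma gibbs_le_nil w : g w <= g [::].
Proof.
rewrite -(sum_gibbs p0 P0 Pv (size w)).
rewrite (bigD1 (in_tuple w)) //= lerDl sumr_ge0 // => u _.
exact: gibbs_ge0.
Qed.

(* Markov's inequality for the exponential moment of order [h] *)
Lemma chernoff (a e h rho' : R) v' : perron_pair P (q + h) rho' v' ->
  ln rho' / lam - ln rho / lam + h * a <= `|h| * (e / 2) ->
  exists2 C, 0 < C & forall n, (0 < n)%N ->
    \sum_(w : n.-tuple 'I_l | (0 < word_weight p P w) &&
        (`|h| * (e * (n%:R * lam)) <= h * (ln (word_weight p P w) + a * (n%:R * lam)))) g w
    <= C * expR (- (`|h| * (e / 2) * (n%:R * lam))).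
Proof.
move=> Pv' gap; have [rho0 v0 _] := Pv; have [rho'0 _ _] := Pv'.
have [C C0 HC] := fin_ub v.
have [b' [b [_ b0 Hb]]] := word_sum_bounds hp hP Pv'.
exists (C * b); first exact: mulr_gt0.
move=> n n0; set K := n%:R * lam.
have K0 : 0 <= K by rewrite mulr_ge0 // ltW.
have /andP[_ {}Hb] := Hb n n0.
(* On the selected words [exp (h * (ln m(I) + a * K) - |h| * e * K)] is at least 1; inserting this
   factor changes the exponent [q] into [q + h]. *)
set E := expR (- (ln rho / lam * K) + h * (a * K) - `|h| * (e * K)).
apply: le_trans (_ : C * E * word_sum p P n (q + h) <= _).
  rewrite /word_sum mulr_sumr big_mkcond /=; apply: ler_sum => w _.
  case: ifPn => [/andP[wp hw]|_]; last by rewrite !mulr_ge0 ?expR_ge0 ?pw_ge0 // ltW.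
  have wn : tval w != [::] by rewrite -size_eq0 size_tuple -lt0n.
  have [i ->] := gibbsE wn; rewrite size_tuple -/K !pwE // -expRD [leLHS]mulrC -[leRHS]mulrA /E -expRD.
  by apply: ler_pM; rewrite ?expR_ge0 ?(ltW (v0 i)) // ler_expR; lra.
apply: le_trans (ler_wpM2l _ Hb) _; first by rewrite mulr_ge0 ?expR_ge0 // ltW.
rewrite -!mulrA ler_pM2l // mulrCA ler_pM2l //.
rewrite -[rho' in leLHS]lnK ?posrE // -expRM_natl /E -expRD ler_expR.
have -> : n%:R * ln rho' = ln rho' / lam * K by rewrite /K; field; rewrite gt_eqF.
by have := ler_wpM2r K0 gap; lra.
Qed.

(** As [P z z] is not 1, some other transition out of [z] is possible; its positive term in the
    eigenvector equation at [z] makes the loop term strictly smaller than [rho * v z]. *)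
Lemma gibbs_loop_lt1 z : P z z != 1 -> 0 <= pw (P z z) q / rho < 1.
Proof.
move=> Pzz; have [rho0 v0 Mv] := Pv; rewrite divr_ge0 ?pw_ge0 1?ltW //=.
rewrite ltr_pdivrMr // mul1r.
have [j jz Pj] : exists2 j, j != z & 0 < P z j.
  apply/not_exists2P => H; move/eqP: Pzz; apply.
  have [_ <-] := hP z; rewrite (bigD1 z) //= big1 ?addr0 // => j jz.
  by have [//|/negP] := H j; rewrite -leNgt => h; apply/eqP; rewrite eq_le h P0.
rewrite -(ltr_pM2r (v0 z)) -Mv /op (bigD1 z) //= ltrDl (bigD1 j) //=.
rewrite ltr_wpDr ?mulr_gt0 ?pw_gt0 // sumr_ge0 // => k _.
by rewrite mulr_ge0 ?pw_ge0 // ltW.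
Qed.

Lemma gibbs_rcons_le w z : g (rcons w z) <= g w.
Proof.
rewrite -(gibbs_rcons p0 P0 Pv w) (bigD1 z) //= lerDl sumr_ge0 // => j _.
exact: gibbs_ge0.
Qed.

Lemma gibbs_nseq w z k :
  g (rcons w z ++ nseq k z) = g (rcons w z) * (pw (P z z) q / rho) ^+ k.
Proof.
have [rho0 _ _] := Pv.
elim: k => [|k IH]; first by rewrite cats0 expr0 mulr1.
rewrite -{1}(addn1 k) nseqD catA cats1 exprSr mulrA -IH.
set u := rcons w z ++ nseq k z.
have : last z u = z by rewrite /u last_cat last_rcons; elim: (k).
have : u != [::] by rewrite /u; case: (w).
case: u => // i s _ lz; have {}lz : last i s = z by [].
transitivity (pw (word_weight p P (rcons (i :: s) z)) q /
  rho ^+ size (rcons (i :: s) z) * v (last i (rcons s z))) => //.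
rewrite last_rcons word_weight_rcons pwM // size_rcons lz /gibbs lz exprS.
by field; rewrite expf_neq0 ?gt_eqF.
Qed.

(** For each [n], sequences constant from rank [n] on lie in cylinders ending in a long run of [z],
    whose total mass decays geometrically with the run. The bounds [eps / 2 ^ (n + 1)] are then
    summed. *)
Lemma covered_eventually_const z (eps : R) : P z z != 1 -> 0 < eps ->
  covered g [set x | exists n, forall i, (n <= i)%N -> x i = z] eps%:E.
Proof.
move=> /gibbs_loop_lt1 az e0; set a := pw (P z z) q / rho in az.
pose B n := [set x : nat -> 'I_l | forall i, (n <= i)%N -> x i = z].
have cB n : covered g (B n) (eps / (2 ^ n.+1)%:R)%:E.
  have [k Hk] := geometric_small (g [::]) az (divr_gt0 e0 (ltr0Sn R (2 ^ n.+1).-1)).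
  have := Hk k (leqnn k); rewrite prednK ?expn_gt0 // => {}Hk.
  have cw := @covered_bigU _ _ _ _ (enum {: n.-tuple 'I_l})
    (fun w : n.-tuple 'I_l => [set x | mkseq x (size (rcons w z ++ nseq k z)) = rcons w z ++ nseq k z]) _
    (fun w _ => covered_word (gibbs_ge0 p Pv) (gibbs_rcons p0 P0 Pv) _).
  apply: (covered_sub _ _ cw).
    move=> x Bx; exists (digits x n); first by rewrite mem_enum.
    rewrite /mkset digitsE size_cat size_nseq size_rcons size_mkseq.
    apply: (@eq_from_nth _ z); first by rewrite size_cat size_nseq size_rcons !size_mkseq.
    move=> i; rewrite size_mkseq => ik; rewrite nth_mkseq //.
    rewrite nth_cat size_rcons size_mkseq nth_rcons size_mkseq nth_nseq.
    have [ni|ni] := leqP n i; last by rewrite (leqW ni) (nth_mkseq _ _ ni).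
    by rewrite (Bx i ni); do !case: ifP.
  rewrite sumEFin lee_fin; apply: le_trans Hk.
  rewrite -(sum_gibbs p0 P0 Pv n) mulr_suml -big_enum /=; apply: ler_sum => w _.
  rewrite gibbs_nseq ler_wpM2r ?gibbs_rcons_le //.
  by rewrite exprn_ge0 //; case/andP: az.
apply: (covered_sub _ _ (covered_bigcup cB)).
  by move=> x [n Hn]; exists n.
by apply: (@epsilon_trick0 _ eps xpredT); exact: ltW.
Qed.

End gibbs_estimates.

(** * The Gibbs measure at the parameter of slope [- a] *)

Section slope.
Variables (rho : R -> R) (v : R -> 'I_l -> R).
Hypothesis Pv : forall q, perron_pair P q (rho q) (v q).
Let T q := ln (rho q) / lam.
Hypothesis tanT : exact_tangents T.
Variables (q a : R).
Hypothesis slope : derive1 T q = - a.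
Local Notation g := (gibbs p P q (rho q) (v q)).

Lemma gibbs_atypical_mass (e : R) : 0 < e -> exists C t, [/\ 0 < C, 0 <= t < 1 &
  forall n, (0 < n)%N ->
    \sum_(w : n.-tuple 'I_l | ~~ typical p P a e w) g w <= C * t ^+ n].
Proof.
move=> e0; have [h h0 H] := exact_tangents_approx q tanT (divr_gt0 e0 (ltr0Sn R 1)).
have gap x : `|x| <= h -> ln (rho (q + x)) / lam - ln (rho q) / lam + x * a <= `|x| * (e / 2).
  by move=> /H; rewrite slope -/(T (q + x)) -/(T q); lra.
have hh : `|h| <= h by rewrite gtr0_norm.
have hN : `|- h| <= h by rewrite normrN.
have [C1 C10 H1] := chernoff (Pv q) (Pv _) (gap h hh).
have [C2 C20 H2] := chernoff (Pv q) (Pv _) (gap (- h) hN).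
exists (C1 + C2), (expR (- (h * (e / 2) * lam))); split; first exact: addr_gt0.
  by rewrite expR_ge0 /= expR_lt1 oppr_lt0 !mulr_gt0 // invr_gt0.
move=> n n0; rewrite mulrDl -expRM_natl.
have -> : n%:R * - (h * (e / 2) * lam) = - (h * (e / 2) * (n%:R * lam)) by ring.
have := H1 n n0; have := H2 n n0; rewrite normrN gtr0_norm // => {}H2 {}H1.
apply: le_trans (lerD H1 H2); rewrite [leLHS]big_mkcond [X in _ <= X + _]big_mkcond.
rewrite [X in _ <= _ + X]big_mkcond /= -big_split /=; apply: ler_sum => w _.
have g0 : 0 <= g w by apply: gibbs_ge0.
case: ifPn => [tw|_]; last by apply: addr_ge0; case: ifP.
have wn : tval w != [::] by rewrite -size_eq0 size_tuple -lt0n.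
have [i gE] := gibbsE (Pv q) wn.
(* Words of zero weight are atypical but carry no Gibbs mass, whatever the sign of [q]. *)
have [w0|w0] := eqVneq (word_weight p P w) 0.
  by rewrite gE w0 pw0 !mul0r addr_ge0 //; case: ifP.
have wp : 0 < word_weight p P w by rewrite lt_neqAle eq_sym w0 wt0.
rewrite /typical wp /= -ltNge size_tuple ltr_normr in tw.
rewrite wp /=; case/orP: tw => tw.
  by rewrite ler_pM2l // (ltW tw) lerDl; case: ifP.
by rewrite mulNr -mulrN (ler_pM2l h0 _ (- _)) (ltW tw) lerDr; case: ifP.
Qed.

(** Borel--Cantelli: for each tolerance [1 / (k + 1)] the atypical masses have a small geometric
    tail, and the tails are made summable in [k]. *)
Lemma covered_atypical (eps : R) : 0 < eps -> exists N : nat -> nat,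
  covered g [set x | exists k n, (N k <= n)%N /\
    ~~ typical p P a k.+1%:R^-1 (digits x n)] eps%:E.
Proof.
move=> eps0.
have /choice[N HN] : forall k, exists N, covered g [set x | exists n, (N <= n)%N /\
    ~~ typical p P a k.+1%:R^-1 (digits x n)] (eps / (2 ^ k.+1)%:R)%:E.
  move=> k; have k0 : 0 < k.+1%:R^-1 :> R by rewrite invr_gt0.
  have [C [t [C0 t01 H]]] := gibbs_atypical_mass k0.
  have [N HN] := geometric_small (C / (1 - t)) t01 (divr_gt0 eps0 (ltr0Sn R (2 ^ k.+1).-1)).
  exists N.+1.
  have cl n := covered_level (gibbs_ge0 p (Pv q)) (gibbs_rcons p0 P0 (Pv q))
    [set w : (N.+1 + n).-tuple 'I_l | ~~ typical p P a k.+1%:R^-1 w]%SET.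
  apply: (covered_sub _ _ (covered_bigcup cl)).
    move=> x [n [Nn tn]]; exists (n - N.+1)%N => //.
    by rewrite /= inE subnKC.
  apply: le_trans (_ : (\sum_(n <oo) (C * t ^+ N.+1 * t ^+ n)%:E <= _)%E).
    apply: lee_nneseries => [n _ _|n _].
      by rewrite lee_fin sumr_ge0 // => w _; exact: gibbs_ge0.
    rewrite lee_fin -mulrA -exprD; under eq_bigl do rewrite inE.
    exact: H.
  rewrite nneseries_geometric // lee_fin mulrAC.
  by have := HN N.+1 (leqnSn N); rewrite prednK ?expn_gt0.
exists N; apply: (covered_sub _ _ (covered_bigcup HN)).
  by move=> x [k [n [Nn tn]]]; exists k => //; exists n.
by apply: (@epsilon_trick0 _ eps xpredT); exact: ltW.
Qed.

Let D := a * q + T q.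

Lemma inv_small (e : R) : 0 < e -> exists k, `|q| / k.+1%:R <= e /\ k.+1%:R^-1 <= e.
Proof.
move=> e0; pose k := Num.truncn ((`|q| + 1) / e); exists k.
have H : (`|q| + 1) / e <= k.+1%:R.
  by apply/ltW; have /andP[] := truncn_itv (divr_ge0 (addr_ge0 (normr_ge0 q) ler01) (ltW e0)).
rewrite ler_pdivrMr // mulrC in H.
have k0 : 0 < k.+1%:R :> R by rewrite ltr0n.
split; first by rewrite ler_pdivrMr // mulrC; have := normr_ge0 q; lra.
by rewrite -[_^-1]mul1r ler_pdivrMr // mulrC; have := normr_ge0 q; lra.
Qed.

(** If [D] were negative, the Gibbs masses of the prefixes of a typical sequence would grow without
    bound, although none exceeds the total mass. *)
Lemma legendre_value_ge0 : 0 <= D.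
Proof.
rewrite leNgt; apply/negP => D0.
have g0 := gibbs_nil_gt0 p0 (Pv q) hp.2.
have [N cN] := covered_atypical (divr_gt0 g0 (ltr0Sn R 1)).
have [|x Hx] := covered_exists_notin (gibbs_rcons p0 P0 (Pv q)) cN.
  by rewrite lte_fin ltr_pdivrMr // ltr_pMr // ltr1n.
have D2 : 0 < - D / 2 by rewrite divr_gt0 // oppr_gt0.
have [k [Hk _]] := inv_small D2.
have [c [C [c0 C0 H]]] := gibbs_typical_bounds (Pv q).
have bound n : (N k < n)%N -> n%:R * (- D / 2 * lam) <= g [::] / c.
  move=> Nn; have tw : typical p P a k.+1%:R^-1 (digits x n).
    by apply/negPn/negP => tw; apply: Hx; exists k, n; rewrite (ltnW Nn).
  have wn : tval (digits x n) != [::] by rewrite -size_eq0 size_tuple -lt0n (leq_ltn_trans _ Nn).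
  have [h _] := H _ _ _ wn tw; have := le_trans h (gibbs_le_nil (Pv q) _).
  rewrite size_tuple mulrC -ler_pdivlMr //; apply: le_trans.
  apply: le_trans (expR_ge1Dx _); rewrite -/(T q) -/D mulrCA.
  have K0 : 0 <= n%:R * lam by rewrite mulr_ge0 // ltW.
  by have := ler_wpM2r K0 Hk; set u := `|q| / _; set K := n%:R * lam in K0 * => ?; nra.
have Dl : 0 < - D / 2 * lam by rewrite mulr_gt0.
pose n := ((N k).+1 + (Num.truncn (g [::] / c / (- D / 2 * lam))).+1)%N.
have := bound n (leq_addr _ _); rewrite -ler_pdivlMr // leNgt => /negP; apply.
have g1 : 0 <= g [::] / c / (- D / 2 * lam) by rewrite !divr_ge0 // ltW.
have /andP[_ /lt_le_trans] := truncn_itv g1; apply.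
by rewrite ler_nat leq_addl.
Qed.

(** Replaces a covering set by an adic scale. Rounding the diameter up to a power of [l] costs the
    factor [l ^ s]; sets of diameter zero have no scale of their own, so one is chosen fine enough
    to cost at most [eta]. *)
Lemma diam_scale (s s' eta : R) N (U : set R) : 0 <= s -> s < s' -> 0 < eta ->
  (diam U <= (l%:R ^- N)%:E)%E -> exists n, [/\ (N <= n)%N,
    (diam U <= (l%:R ^- n)%:E)%E &
    ((expR (- (s' * (n%:R * lam))))%:E <=
      (expR (s * lam))%:E * diam_pow s U + eta%:E)%E].
Proof.
move=> s0 ss' eta0 dU; have ln0 n : 0 < l%:R ^+ n :> R by rewrite exprn_gt0 // ltr0n.
have lnE n : l%:R ^- n = expR (- (n%:R * lam)) :> R.
  by rewrite expRN expRM_natl lnK // posrE ltr0n.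
have dp0 : (0 <= (expR (s * lam))%:E * diam_pow s U)%E.
  by rewrite mule_ge0 ?lee_fin ?expR_ge0 // diam_pow_ge0.
have s'0 : 0 < s' by exact: le_lt_trans ss'.
have [U0|U0] := leP (diam U) 0%E.
  have t01 : 0 <= expR (- (s' * lam)) < 1.
    by rewrite expR_ge0 /= expR_lt1 oppr_lt0 mulr_gt0.
  have [n Hn] := geometric_small 1 t01 eta0.
  exists (N + n)%N; split; first exact: leq_addr.
    by apply: le_trans U0 _; rewrite lee_fin invr_ge0 ltW.
  apply: le_trans (_ : (eta%:E <= _)%E); last by rewrite leeDr.
  have := Hn (N + n)%N (leq_addl _ _); rewrite mul1r lee_fin -expRM_natl.
  by congr (expR _ <= _); ring.
have fU : (diam U) \is a fin_num.
  by rewrite ge0_fin_numE ?ltW // (le_lt_trans dU) ?ltry.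
set t := fine (diam U); have tE : diam U = t%:E by rewrite /t fineK.
rewrite tE lte_fin lee_fin in U0 dU *.
(* The largest order [n] for which the diameter is still at most [l ^ (- n)]. *)
pose n := Num.truncn (- ln t / lam).
have tl k : (t <= l%:R ^- k) = (k%:R * lam <= - ln t).
  by rewrite lnE -{1}[t]lnK ?posrE // ler_expR lerNr.
rewrite tl in dU.
have pos : 0 <= - ln t / lam.
  by rewrite divr_ge0 ?(ltW lam0) // (le_trans _ dU) // mulr_ge0 // ltW.
have /andP[n1 n2] := truncn_itv pos.
rewrite -/n ler_pdivlMr // in n1; rewrite -/n ltr_pdivrMr // in n2.
exists n; split.
- rewrite -ltnS -(ltr_nat R) -(ltr_pM2r lam0); exact: le_lt_trans n2.
- by rewrite lee_fin tl.
rewrite /diam_pow; case: eqP => [U_0|_].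
  by move: tE; rewrite U_0 diam_set0.
rewrite tE poweR_EFin -EFinM -EFinD lee_fin -[leLHS]addr0 lerD ?(ltW eta0) //.
rewrite /powR gt_eqF // -expRD ler_expR.
rewrite -natr1 in n2.
have nl : 0 <= n%:R * lam by rewrite mulr_ge0 // ltW.
nra.
Qed.

Hypothesis P1 : forall i j, P i j != 1.

(** Mass distribution principle: for [s < D], a cover of small [s]-weight meets typical cylinders of
    small total Gibbs mass. A sequence avoiding these and the other exceptional sets codes a point
    of the level set that the cover misses. *)
Lemma null_level_set_exponent_ge (s : R) : 0 <= s ->
  hausdorff_measure s (level_set l m a) = 0%E -> D <= s.
Proof.
move=> s0 Hs; rewrite leNgt; apply/negP => sD.
pose s' := (s + D) / 2; have ss' : s < s' by rewrite midf_lt.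
have s'D : 0 < D - s' by rewrite subr_gt0 midf_lt.
have g0 := gibbs_nil_gt0 p0 (Pv q) hp.2.
(* Three exceptional sets are removed (atypical sequences, sequences eventually [l - 1], sequences
   caught by the cover), each at a quarter of the total mass. *)
have g4 : 0 < g [::] / 4 by rewrite divr_gt0.
have [N cN] := covered_atypical g4.
have zl : (l.-1 < l)%N by rewrite prednK.
pose z := Ordinal zl.
have cz := covered_eventually_const (Pv q) (P1 z z) g4.
(* At tolerance [1 / (k + 1)] the exponent of a typical Gibbs weight loses at most [D - s'], so it
   stays at least [s']. *)
have [k [Hk _]] := inv_small s'D.
have [c [C [c0 C0 HC]]] := gibbs_typical_bounds (Pv q).
pose L := expR (s * lam); have L0 : 0 < L by exact: expR_gt0.
(* Solves [3 * C * (L * delta + delta) = g [::] / 4]: three cylinders per set, the [s]-weight of the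
   cover below [delta], and the errors of [diam_scale] summing to [delta]. *)
pose delta := g [::] / 4 / (3 * C * (L + 1)).
have CL : 0 < 3 * C * (L + 1) by rewrite !mulr_gt0 // addr_gt0.
have delta0 : 0 < delta by rewrite divr_gt0.
pose d : R := l%:R ^- (N k).+1.
have d0 : 0 < d by rewrite invr_gt0 exprn_gt0 // ltr0n.
have [_ [U [EU Ud] <-] Usum] : exists2 S, [set (\sum_(0 <= i <oo) diam_pow s (U i))%E | U in
    [set U : (set R)^nat | level_set l m a `<=` \bigcup_i U i /\
       forall i, (diam (U i) <= d%:E)%E]] S & (S < delta%:E)%E.
  apply: ereal_inf_lt; apply: le_lt_trans (_ : (0 < _)%E); last by rewrite lte_fin.
  by rewrite -[leRHS]Hs; apply: ereal_sup_ubound; exists d.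
have /choice[n Hn] : forall i, exists n, [/\ ((N k).+1 <= n)%N,
    (diam (U i) <= (l%:R ^- n)%:E)%E &
    ((expR (- (s' * (n%:R * lam))))%:E <=
      L%:E * diam_pow s (U i) + (delta / (2 ^ i.+1)%:R)%:E)%E].
  move=> i; apply: diam_scale => //.
  by rewrite divr_gt0 // ltr0n expn_gt0.
pose W i := [set w : (n i).-tuple 'I_l |
  `[< exists2 y, U i y & cylinder R w y >] && typical p P a k.+1%:R^-1 w]%SET.
have cW := covered_bigcup (fun i =>
  covered_level (gibbs_ge0 p (Pv q)) (gibbs_rcons p0 P0 (Pv q)) (W i)).
have massW i : ((\sum_(w in W i) g w)%:E <=
    (3 * C)%:E * (L%:E * diam_pow s (U i) + (delta / (2 ^ i.+1)%:R)%:E))%E.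
  have [Nn dU Hi] := Hn i.
  apply: le_trans (_ : ((3 * C * expR (- (s' * ((n i)%:R * lam))))%:E <= _)%E); last first.
    by rewrite EFinM lee_wpmul2l // lee_fin mulr_ge0 // ltW.
  rewrite lee_fin; apply: le_trans (_ : \sum_(w in W i) C * expR (- (s' * ((n i)%:R * lam))) <= _).
    apply: ler_sum => w; rewrite inE => /andP[_ tw].
    have wn : tval w != [::] by rewrite -size_eq0 size_tuple -lt0n (leq_trans _ Nn).
    have [_ h] := HC _ _ _ wn tw; apply: le_trans h _.
    rewrite ler_pM2l // ler_expR size_tuple -/(T q) -/D lerN2.
    by rewrite ler_wpM2r ?mulr_ge0 ?(ltW lam0) // lerBrDr addrC -lerBrDr.
  rewrite sumr_const -[_ *+ #|_|]mulr_natl -mulrA ler_wpM2r ?mulr_ge0 ?expR_ge0 ?(ltW C0) //.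
  rewrite (ler_nat R _ 3); apply: leq_trans (card_cylinders_meeting l0 dU).
  by apply: subset_leq_card; apply/fintype.subsetP => w; rewrite !inE => /andP[/asboolP].
have sumW : (\sum_(i <oo) (\sum_(w in W i) g w)%:E <= (g [::] / 4)%:E)%E.
  apply: le_trans (_ : (\sum_(i <oo) ((3 * C)%:E * (L%:E * diam_pow s (U i) + (delta / (2 ^ i.+1)%:R)%:E)) <= _)%E).
    apply: lee_nneseries => [j _ _|j _]; last exact: massW.
    by rewrite lee_fin sumr_ge0 // => w _; exact: gibbs_ge0.
  have dp0 i : (0 <= L%:E * diam_pow s (U i))%E.
    by rewrite mule_ge0 ?diam_pow_ge0 // lee_fin ltW.
  rewrite nneseriesZl; last first.
    by move=> i _; rewrite adde_ge0 // lee_fin divr_ge0 // ltW.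
  apply: le_trans (_ : (3 * C)%:E * (L * delta + delta)%:E <= _)%E; last first.
    rewrite -EFinM lee_fin /delta le_eqVlt; apply/orP; left; apply/eqP.
    by field; rewrite !gt_eqF // addr_gt0.
  rewrite lee_wpmul2l ?lee_fin ?mulr_ge0 ?(ltW C0) //.
  apply: le_trans (epsilon_trick _ _ (ltW delta0)) _ => //.
  rewrite EFinD leeD2r // nneseriesZl; last by move=> i _; exact: diam_pow_ge0.
  by rewrite EFinM lee_wpmul2l ?lee_fin ?(ltW L0) // ltW.
have [|x Hx] := covered_exists_notin (gibbs_rcons p0 P0 (Pv q))
    (covered_setU (covered_setU cN cz) cW).
  apply: le_lt_trans (leeD (lexx _) sumW) _.
  by rewrite -!EFinD lte_fin; lra.
(* Since [x] is not eventually [l - 1], it is the digit expansion of a point [y]. *)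
have [|y xy] := @expansion_exists _ R x l0.
  move=> j; apply: contrapT => Hj; apply: Hx; left; right; exists j => i ji.
  apply/val_inj/eqP; rewrite eqn_leq /= -ltnS prednK // ltn_ord /=.
  by rewrite -ltnS prednK // leqNgt; apply/negP => xl; apply: Hj; exists i.
have typ k' n' (w : n'.-tuple 'I_l) : (N k' <= n')%N -> cylinder R w y ->
    typical p P a k'.+1%:R^-1 w.
  move=> Nn' wy; rewrite (cylinder_unique l0 wy (xy n')).
  by apply/negPn/negP => tw; apply: Hx; left; left; exists k', n'.
have Ey : level_set l m a y.
  apply: (typical_level_set l1 hp hP hm (cylinder_sub01 l0 (xy 0%N))) => e e0.
  have [k' [_ Hk']] := inv_small e0; exists (N k') => n' w Nn' wy.
  have /andP[wp h] := typ _ _ _ Nn' wy; rewrite /typical wp (le_trans h) //.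
  by rewrite ler_wpM2r // mulr_ge0 // ltW.
have [i _ Uy] := EU y Ey; have [Nn _ _] := Hn i.
apply: Hx; right; exists i => //; rewrite /= inE typ ?(ltnW Nn) // andbT.
by apply/asboolP; exists y.
Qed.

End slope.
End lower_bound.

Theorem theorem4p1 (R : realType) (l : nat) (hl : (2 <= l)%N)
    (p : 'I_l -> R) (P : 'M[R]_l)
    (hp : prob_vector p) (hP : stochastic P)
    (hP1 : forall i j, P i j != 1)
    (hirr : irreducible_mx P)
    (m : probability (measurableTypeR R) R)
    (hm : markov_measure p P m)
    (alpha : R)
    (halpha1 : (- tau_deriv_pinfty l m < alpha%:E)%E)
    (halpha2 : (alpha%:E < - tau_deriv_ninfty l m)%E) :
  hausdorff_dim (level_set l m alpha) = tau_star l m alpha.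
Proof.
have P0 i j : 0 <= P i j by case: (hP i).
have /choice[rho /choice[v Pv]] := perron_pair_exists hl hirr.
have lam0 := ln_l_gt0 (R := R) hl.
pose T q := ln (rho q) / ln l%:R.
have tauT q : tau l m q = (T q)%:E by exact: (tauE hl hp hP hm (Pv q)).
have tanT : exact_tangents T.
  move=> q; have [c [K [h0 [h00 H]]]] := ln_perron_tangent hl P0 hirr (Pv q).
  exists (c / ln l%:R), (K / ln l%:R), h0; split => // h.
  have [H1 H2] := H h _ _ (Pv (q + h)).
  have -> : T (q + h) - T q = (ln (rho (q + h)) - ln (rho q)) / ln l%:R by rewrite -mulrBl.
  rewrite mulrA ler_pM2r ?invr_gt0 //; split => // /H2 {}H2.
  by rewrite [K / _ * _]mulrAC -mulrDl ler_pM2r ?invr_gt0.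
have dT : tau_deriv l m = derive1 T.
  by congr derive1; apply/funext => q; rewrite tauT.
rewrite /tau_deriv_pinfty dT in halpha1; rewrite /tau_deriv_ninfty dT in halpha2.
have [q slope] := exact_tangents_slope tanT halpha1 halpha2.
pose D := alpha * q + T q.
have D0 : 0 <= D by exact: (legendre_value_ge0 hl hp hP Pv tanT slope).
have -> : tau_star l m alpha = D%:E.
  apply/eqP; rewrite eq_le; apply/andP; split.
    by apply: ereal_inf_lbound; exists q; rewrite // tauT.
  (* The supporting line of [T] at [q] has slope [- alpha], so [alpha * r + T r] is minimal at
     [r = q]. *)
  apply: le_ereal_inf_tmp => _ [r _ <-]; rewrite tauT -EFinD lee_fin /D.
  have := exact_tangents_supporting q (r - q) tanT.
  by rewrite slope subrKC; lra.
apply/eqP; rewrite eq_le; apply/andP; split; last first.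
  apply: le_ereal_inf_tmp => _ [s [s0 Hs] <-]; rewrite lee_fin.
  exact: (null_level_set_exponent_ge hl hp hP hm Pv tanT slope hP1 s0 Hs).
(* Each exponent [D + e] is admissible in the definition of the dimension; [D >= 0] guarantees its
   sign. *)
apply/lee_addgt0Pr => e e0; apply: ereal_inf_lbound; exists (D + e) => //; split.
  by rewrite addr_ge0 // ltW.
apply: (hausdorff_measure_level_set_eq0 hl hp hP hm (Pv q)); last by rewrite ltrDl.
by rewrite addr_ge0 // ltW.
Qed.
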